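(* Let $m/n\in(0,1/2)$. There is a bijection $\phi\colon\mathcal P(1/2,0,B)\to\mathcal P(m/n,m-1,B)$ defined on data as follows: in the cycle representation of $\pi$, replace each occurrence of $(0,s)$ (keeping its label $A$, $B$ or $C$) by the string $(m-1,s)\to(2m-1,s)\to\cdots\to(n-m,s)\to(0,s)$, i.e. the points $(r,s)$ for $r$ running through $\mathcal O_{m/n}[m-1,0]$ in order, and each occurrence of $(1,s)$ by the string $(m,s)\to(2m,s)\to\cdots\to(n-1,s)$, i.e. the points $(r,s)$ for $r$ running through $\mathcal O_{m/n}[m,n-1]$ in order; the partition $(A,B,C)$ is unchanged. Moreover $\phi$ restricts to a bijection $TT(1/2,0,B)\to TT(m/n,m-1,B)$.
   Context: $\Gamma_n$ is an $n$-star (edges $e_0,\dots,e_{n-1}$, central vertex $v$); $f_{m/n}(e_0)=e_0\bar e_1e_1\cdots\bar e_me_m$, $f_{m/n}(e_r)=e_{r+_nm}$ ($r\ne0$), with $+_n$ addition mod $n$. $\mathcal O_{m/n}[r,s]=\{r+_njm\colon0\le j\le k\}$ with $k\ge0$ least such that $r+_nkm=s$. A $\ast$-orbit is a periodic orbit $P\ne\{v\}$ of $f_{m/n}$ meeting every edge, with $f_{m/n}(P\cap e_0)\not\subseteq e_m$ and $f(p_r)=p_{r+_nm}$ for $r\neq 0$ ($p_r$ the point of $P\cap e_r$ nearest the initial point of $e_r$). Its data $((N_r),\pi,(A,B,C))$: $N_r=\#(P\cap e_r)$, points labelled $(r,0),\dots,(r,N_r-1)$ from initial to final point, $\pi=f|_P$,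 and $s\in A,B,C$ according as the truncated map ($f$ followed by retraction onto the span of $P$) is locally orientation-reversing, orientation-preserving, or not injective at $(0,s)$. $\mathcal P(m/n,k,\gamma)$ is the set of $\ast$-orbits with $\pi(0,0)\in e_k$ and $0\in\gamma$; $\ast$-orbits with equal data are identified. $TT(m/n,k,\gamma)\subseteq\mathcal P(m/n,k,\gamma)$ consists of those satisfying: with $\alpha\cup\beta$ the partition of $\mathcal L\setminus\{(r,0)\}$ given by $\pi^{-1}(m,0)\in\beta$ and, for $2\le i\le\#P-n$, $\pi^{-i}(m,0)$, $\pi^{-i+1}(m,0)$ in different sets iff $\tau_1(\pi^{-i}(m,0))=0$ and $\tau_2(\pi^{-i}(m,0))\in A$ ($\tau_1,\tau_2$ coordinate projections, $\pi_i=\tau_i\circ\pi$): (a) for $0\le s<N_0-1$, $\pi(0,s)\in\alpha$ if $s\in B$, $\in\beta$ if $s\in A$; (b) $N_{r+n-m}=1$ for $k<r<m$; (c) if $s>0$ and $\pi_2(k+n-m,s)>\pi_2(0,0)$ then $\pi(k+n-m,s)\in\beta$; (d) if $\gamma=A$ then $\pi_2(k+n-m,s)>\pi_2(0,0)$ for all $s>0$. *)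

(* Defs.v *)
From mathcomp Require Import all_boot all_order all_algebra.
From mathcomp Require Import reals.
Set Implicit Arguments. Unset Strict Implicit. Unset Printing Implicit Defensive.
Import Order.TTheory GRing.Theory Num.Theory.

(* The n-star Gamma_n.  A point is either the central vertex v (SV), or *)
(* SE r t : the point of edge e_r (r < n) at parameter t, 0 <= t < 1,   *)
(* where t = 0 is the initial point of e_r and t -> 1 tends to v (the   *)
(* final point of every e_r is v, as forced by f(e_0)=e_0 ē_1 e_1 ...). *)
Inductive spoint (R : Type) := SV | SE of nat & R.
Arguments SV {R}.

Section Star.
Local Open Scope ring_scope.
Variable R : realType.

Definition valid_pt (n : nat) (y : spoint R) : Prop :=
  match y with SV => True | SE r t => (r < n)%N /\ 0 <= t /\ t < 1 end.

Definition mkpt (r : nat) (x : R) : spoint R := if x == 1 then SV else SE r x.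

(* The map f_{m/n}: each e_r (r <> 0) is mapped isometrically onto
   e_{r +_n m}; e_0 is cut into 2m+1 equal subintervals, the j-th being
   mapped affinely onto e_0 (j = 0), onto ē_i (j = 2i-1), onto e_i (j = 2i),
   realizing the edge path e_0 ē_1 e_1 ... ē_m e_m. *)
Definition fmap (n m : nat) (y : spoint R) : spoint R :=
  match y with
  | SV => SV
  | SE r t =>
    if r == 0%N then
      let s := (2 * m + 1)%N%:R * t in
      let j := Num.truncn s in
      let u := s - j%:R in
      if j == 0%N then SE 0 u
      else if odd j then mkpt (j.+1)./2 (1 - u)
      else SE j./2 u
    else SE ((r + m) %% n) t
  end.

(* the orbit of x (a periodic point generates the periodic orbit P) *)
Definition in_orb (n m : nat) (x y : spoint R) : Prop :=
  exists i, y = iter i (fmap n m) x.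

Definition is_first (n m : nat) (x : spoint R) (r : nat) (y : spoint R) : Prop :=
  exists t, y = SE r t /\ in_orb n m x y /\
    forall u, in_orb n m x (SE r u) -> t <= u.

Definition star_orbit (n m : nat) (x : spoint R) : Prop :=
  valid_pt n x /\
  (exists p, (0 < p)%N /\ iter p (fmap n m) x = x) /\
  (exists y, in_orb n m x y /\ y <> SV) /\
  (forall r, (r < n)%N -> exists t, in_orb n m x (SE r t)) /\
  (exists t, in_orb n m x (SE 0 t) /\
             forall u, fmap n m (SE 0 t) <> SE m u) /\
  (forall r, (0 < r < n)%N -> forall y,
      is_first n m x r y -> is_first n m x ((r + m) %% n) (fmap n m y)).

(* labelling: N_r = #(P cap e_r), and tc r s is the parameter of the
   point (r,s), labelled from the initial point to the final point *)
Definition labelling (n m : nat) (x : spoint R) (N : seq nat)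
    (tc : nat -> nat -> R) : Prop :=
  size N = n /\
  forall r, (r < n)%N ->
    (forall s1 s2, (s1 < s2)%N -> (s2 < nth 0%N N r)%N -> tc r s1 < tc r s2) /\
    (forall t, in_orb n m x (SE r t) <->
               exists2 s, (s < nth 0%N N r)%N & t = tc r s).

(* truncated map: f followed by the retraction onto the span of P
   (the span of P, which meets every edge, is {v} together with the
   segments of each e_r from p_r = (r,0) to v) *)
Definition trunc (n m : nat) (tc : nat -> nat -> R) (y : spoint R) : spoint R :=
  match fmap n m y with
  | SV => SV
  | SE r u => SE r (Num.max u (tc r 0%N))
  end.

Definition near0 (t t1 : R) (e : R) := 0 <= t1 /\ t1 < 1 /\ `|t1 - t| < e.

Definition loc_rev (g : spoint R -> spoint R) (t : R) : Prop :=
  exists e, 0 < e /\ exists r, forall t1 t2, near0 t t1 e -> near0 t t2 e ->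
    t1 < t2 -> exists u1 u2, g (SE 0 t1) = SE r u1 /\ g (SE 0 t2) = SE r u2
                             /\ u2 < u1.
Definition loc_pres (g : spoint R -> spoint R) (t : R) : Prop :=
  exists e, 0 < e /\ exists r, forall t1 t2, near0 t t1 e -> near0 t t2 e ->
    t1 < t2 -> exists u1 u2, g (SE 0 t1) = SE r u1 /\ g (SE 0 t2) = SE r u2
                             /\ u1 < u2.
Definition loc_noninj (g : spoint R -> spoint R) (t : R) : Prop :=
  forall e, 0 < e -> exists t1 t2, near0 t t1 e /\ near0 t t2 e /\
    t1 <> t2 /\ g (SE 0 t1) = g (SE 0 t2).

End Star.

(* Data ((N_r), pi, (A,B,C)).  Labels are pairs (r,s) : nat * nat with  *)
(* r < n, s < N_r.  pi is normalised to the identity off labels, and    *)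
(* A, B, C are subsets of {0,..,N_0 - 1} (given as boolean predicates). *)
Record data := Data {
  dN : seq nat;
  dpi : nat * nat -> nat * nat;
  dA : nat -> bool; dB : nat -> bool; dC : nat -> bool }.

Definition is_label (N : seq nat) (p : nat * nat) : bool :=
  (p.1 < size N)%N && (p.2 < nth 0%N N p.1)%N.

Definition data_of (R : realType) (n m : nat) (x : spoint R) (d : data) : Prop :=
  exists tc : nat -> nat -> R,
  labelling n m x (dN d) tc /\
      (forall p, is_label (dN d) p ->
         is_label (dN d) (dpi d p) /\
         fmap n m (SE p.1 (tc p.1 p.2)) = SE (dpi d p).1 (tc (dpi d p).1 (dpi d p).2)) /\
  (forall p, ~~ is_label (dN d) p -> dpi d p = p) /\
  (forall s, dA d s <-> (s < nth 0%N (dN d) 0)%N /\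
                        loc_rev (trunc n m tc) (tc 0%N s)) /\
  (forall s, dB d s <-> (s < nth 0%N (dN d) 0)%N /\
                        loc_pres (trunc n m tc) (tc 0%N s)) /\
  (forall s, dC d s <-> (s < nth 0%N (dN d) 0)%N /\
                        loc_noninj (trunc n m tc) (tc 0%N s)).

Inductive lab := LA | LB | LC.
Definition lab_set (d : data) (g : lab) : nat -> bool :=
  match g with LA => dA d | LB => dB d | LC => dC d end.

Definition Pset (R : realType) (n m k : nat) (g : lab) (d : data) : Prop :=
  exists x : spoint R, [/\ star_orbit n m x, data_of n m x d,
    (dpi d (0, 0)%N).1 = k & lab_set d g 0%N].

Definition bwd (d : data) (m i : nat) : nat * nat :=
  iter (sumn (dN d) - i) (dpi d) (m, 0%N).   (* = pi^{-i}(m,0) *)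

(* colour of pi^{-i}(m,0): true = beta, false = alpha  (i >= 1) *)
Fixpoint col (d : data) (m i : nat) : bool :=
  match i with
  | 0 => true
  | 1 => true
  | i'.+1 => let y := bwd d m i in
             if (y.1 == 0%N) && dA d y.2 then ~~ col d m i' else col d m i'
  end.

Definition in_beta (d : data) (n m : nat) (y : nat * nat) : Prop :=
  exists i, [/\ (1 <= i <= sumn (dN d) - n)%N, bwd d m i = y & col d m i].
Definition in_alpha (d : data) (n m : nat) (y : nat * nat) : Prop :=
  exists i, [/\ (1 <= i <= sumn (dN d) - n)%N, bwd d m i = y & ~~ col d m i].

Definition TTset (R : realType) (n m k : nat) (g : lab) (d : data) : Prop :=
  let N := dN d in let pi := dpi d in
  let q := (k + n - m)%N in
  [/\ Pset R n m k g d,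
      (forall s, (s.+1 < nth 0%N N 0)%N ->
         (dB d s -> in_alpha d n m (pi (0%N, s))) /\
         (dA d s -> in_beta d n m (pi (0%N, s)))),
      (forall r, (k < r < m)%N -> nth 0%N N (r + n - m) = 1%N),
      (forall s, (0 < s)%N -> (s < nth 0%N N q)%N ->
         ((pi (0%N, 0%N)).2 < (pi (q, s)).2)%N -> in_beta d n m (pi (q, s))) &
      (g = LA -> forall s, (0 < s)%N -> (s < nth 0%N N q)%N ->
         ((pi (0%N, 0%N)).2 < (pi (q, s)).2)%N)].

Definition Olist (n m a b : nat) : seq nat :=
  let sq := [seq (a + j * m) %% n | j <- iota 0 n] in
  take (index b sq).+1 sq.

Definition expand (n m : nat) (p : nat * nat) : seq (nat * nat) :=
  if p.1 == 0%N then [seq (r, p.2) | r <- Olist n m (m - 1) 0]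
  else [seq (r, p.2) | r <- Olist n m m (n - 1)].

Definition cyc (d : data) : seq (nat * nat) :=
  traject (dpi d) (0%N, 0%N) (sumn (dN d)).

Definition phi (n m : nat) (d : data) : data :=
  let c := flatten [seq expand n m p | p <- cyc d] in
  Data [seq count (fun p : nat * nat => p.1 == r) c | r <- iota 0 n]
       (next c) (dA d) (dB d) (dC d).

(* Main.v *)
(* Let [t] be the parameter on each edge.  On a star-orbit of [P(m/n, m-1, B)]
   the leftmost point [p_0] of [e_0] is mapped, preserving orientation, into
   [e_{m-1}]; so the orbit only uses the last three of the [2m+1] subintervals
   of [e_0], mapped onto [e_{m-1}], [e_m] backwards and [e_m].  From [e_{m-1}]
   or [e_m] a point is carried back to [e_0] at constant [t] along the lists
   [O[m-1, 0]] and [O[m, n-1]].  Hence the first return map to [e_0] is a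
   piecewise affine zigzag with three branches, of slope [2m+1] in absolute
   value, and the order of the points of the orbit is determined by the
   itinerary.  A periodic itinerary is realised for every slope, so the same
   itinerary gives a star-orbit for [1/2] and one for [m/n], whose data are
   both read off from the itinerary and are exchanged by [phi].  The colouring
   of [TT] is constant along [O[m-1, 0]] and [O[m, n-1]]. *)
Require Import Defs.
From mathcomp Require Import all_boot all_order all_algebra.
From mathcomp Require Import reals.
From mathcomp Require Import zify ring lra boolp.
Set Implicit Arguments. Unset Strict Implicit. Unset Printing Implicit Defensive.
Import Order.TTheory GRing.Theory Num.Theory.

(** * Rotation of the edges *)

(** The proof passes through a pair [(b, L)]: one period of the itinerary and the left-to-right
    order of its times. Neither mentions [m] or [n]. A point of the orbit becomes a pair (edge,
    time), [mkdata] produces data from [(b, L)] on either star, and [phi] becomes an identity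
    between two instances of [mkdata]. Two conditions on [b] carry the hypotheses. [b 0 = 0] holds
    because [p_0] is mapped into [e_{m-1}], the label [B] discarding the subinterval that covers
    [e_{m-1}] backwards. [b p.-1 != 0] encodes f(p_r) = p_{r+m}: the point [p_0] is reached through
    [e_m], so time 0 is present and leftmost on every edge. The same conditions keep the periodic
    point built for another slope off the endpoints of [e_0], since an orbit at an endpoint would
    use one branch, 0 or 2, forever. *)

Section Rotation.
Variables n m : nat.
Hypotheses (m_gt0 : 0 < m) (lt_mn : m < n) (co_mn : coprime m n).

Definition shift r := (r + m) %% n.
Definition O0 := Olist n m (m - 1) 0.
Definition O1 := Olist n m m (n - 1).

Let n_gt0 : 0 < n. Proof. exact: leq_ltn_trans lt_mn. Qed.

Lemma iter_shift a j : a < n -> iter j shift a = (a + j * m) %% n.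
Proof.
move=> lt_an; elim: j => [|j IHj]; first by rewrite /= addn0 modn_small.
by rewrite iterS IHj /shift modnDml -addnA mulSn (addnC m).
Qed.

Lemma shift_lt r : shift r < n. Proof. exact: ltn_pmod. Qed.

Lemma OlistE a c : a < n ->
  Olist n m a c = take (index c (traject shift a n)).+1 (traject shift a n).
Proof.
move=> lt_an; rewrite /Olist.
suff -> : [seq (a + j * m) %% n | j <- iota 0 n] = traject shift a n by [].
apply: (@eq_from_nth _ 0); rewrite size_map size_iota ?size_traject // => i lt_in.
rewrite (nth_map 0) ?size_iota // nth_iota // -iter_shift //.
by rewrite (set_nth_default a) ?size_traject // nth_traject.
Qed.

Lemma nth_traject0 (f : nat -> nat) x k i : i < k -> nth 0 (traject f x k) i = iter i f x.
Proof. by move=> lt_ik; rewrite (set_nth_default x) ?size_traject ?nth_traject. Qed.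

Lemma traject_shift_uniq a : a < n -> uniq (traject shift a n).
Proof.
move=> lt_an; apply/(uniqP 0) => i j; rewrite !inE size_traject => lt_i lt_j.
rewrite !nth_traject0 // !iter_shift // => /eqP.
rewrite eqn_modDl.
wlog le_ij : i j lt_i lt_j / i <= j.
  move=> wlg E; case: (leqP i j) => [le|/ltnW le]; first exact: wlg E.
  by apply/esym/(wlg j i) => //; rewrite eq_sym.
rewrite eq_sym eqn_mod_dvd ?leq_mul2r ?le_ij ?orbT // -mulnBl.
rewrite Gauss_dvdl 1?coprime_sym // => dv; apply/eqP; rewrite eqn_leq le_ij /=.
case: (posnP (j - i)) dv => [|gt0 /(dvdn_leq gt0)]; lia.
Qed.

Lemma mem_traject_shift a r : a < n -> r < n -> r \in traject shift a n.
Proof.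
move=> lt_an lt_rn.
have sub : {subset traject shift a n <= iota 0 n}.
  by move=> x /trajectP[i _ ->]; rewrite mem_iota iter_shift //= ltn_pmod.
have [_ E] := uniq_min_size (traject_shift_uniq lt_an) sub
  (eq_leq (etrans (size_iota _ _) (esym (size_traject _ _ _)))).
by rewrite E mem_iota.
Qed.

Lemma last_traject_shift : last m (traject shift m n) = 0.
Proof.
rewrite (last_nth 0) size_traject; case: n n_gt0 lt_mn iter_shift => // k _ lt_mk E.
by rewrite -[nth _ _ _]/(nth 0 (traject shift m k.+1) k) nth_traject0 // E // -mulSn modnMr.
Qed.

(** The rotation sends [n - 1] to [m - 1], so cutting the orbit of [m] just after [n - 1] leaves a
    tail that starts like [O0]; this tail ends at n m = 0 mod n, where [O0] stops as well. *)
Lemma O1_O0 : traject shift m n = O1 ++ O0.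
Proof.
have lt1n : n - 1 < n by lia.
have := last_traject_shift; have := traject_shift_uniq lt_mn.
have := mem_traject_shift lt_mn lt1n.
rewrite /O1 OlistE //; set T := traject shift m n => inT uT lastT.
have fT : fpath shift m (behead T).
  by rewrite /T; case: (n) n_gt0 => //= k _; exact: fpath_traject.
have TE : T = m :: behead T by rewrite /T; case: (n) n_gt0.
have [p1 [p2 defT]] : exists p1 p2, T = rcons p1 (n - 1) ++ p2.
  by clearbody T; case/path.splitP: inT => p1 p2; exists p1, p2.
have nin1 : n - 1 \notin p1.
  by move: uT; rewrite defT cat_uniq rcons_uniq => /andP[/andP[]].
have -> : index (n - 1) T = size p1.
  rewrite defT cat_rcons index_cat (negbTE nin1) /= eqxx addn0 //.
have sz : size p1 + (size p2).+1 = n.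
  by rewrite -[n in RHS](size_traject shift m) -/T defT size_cat size_rcons; lia.
rewrite {2}defT take_cat size_rcons ltnn subnn take0 cats0 defT; congr (_ ++ _).
have p2E : p2 = traject shift (m - 1) (size p2).
  apply: (@eq_from_nth _ 0); rewrite ?size_traject // => i lti.
  have -> : nth 0 p2 i = nth 0 T ((size p1).+1 + i).
    by rewrite defT nth_cat size_rcons ltnNge leq_addr /= addKn.
  have En : nth 0 T (size p1) = n - 1.
    by rewrite defT cat_rcons nth_cat ltnn subnn.
  rewrite [RHS]nth_traject0 // nth_traject0; last lia.
  rewrite addnC iterD iterS; move: En; rewrite nth_traject0; last lia.
  move=> ->; congr (iter _ _ _); rewrite /shift.
  by rewrite (_ : n - 1 + m = m - 1 + n) ?modnDr ?modn_small; lia.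
have p2N : p2 != [::].
  apply: contra_eq_neq lastT => p20; rewrite defT p20 cats0 last_rcons; lia.
have lastp2 : last 0 p2 = 0.
  by move: lastT p2N; rewrite defT last_cat; case: (p2).
have up2 : uniq p2 by move: uT; rewrite defT cat_uniq => /and3P[].
rewrite /O0 OlistE; last lia.
have -> : traject shift (m - 1) n = p2 ++ traject shift (iter (size p2) shift (m - 1)) (size p1).+1.
  by rewrite {1}p2E -trajectD; congr traject; lia.
case/lastP: (p2) p2N lastp2 up2 => // s y _; rewrite last_rcons => ->.
rewrite rcons_uniq => /andP[nin us].
have -> : index 0 (rcons s 0 ++ traject shift (iter (size (rcons s 0)) shift (m - 1)) (size p1).+1) = size s.
  by rewrite cat_rcons index_cat (negbTE nin) /= addn0.
by rewrite take_cat size_rcons ltnn subnn take0 cats0.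
Qed.

Lemma O10_uniq : uniq (O1 ++ O0).
Proof. by rewrite -O1_O0 traject_shift_uniq. Qed.

Lemma O1_uniq : uniq O1. Proof. by have := O10_uniq; rewrite cat_uniq => /and3P[]. Qed.
Lemma O0_uniq : uniq O0. Proof. by have := O10_uniq; rewrite cat_uniq => /and3P[]. Qed.

Lemma mem_O10 r : (r \in O1) || (r \in O0) = (r < n).
Proof.
rewrite -mem_cat -O1_O0; apply/idP/idP; last exact: mem_traject_shift.
by case/trajectP => i _ ->; rewrite iter_shift // ltn_pmod.
Qed.

Lemma O0_lt r : r \in O0 -> r < n. Proof. by rewrite -mem_O10 => ->; rewrite orbT. Qed.
Lemma O1_lt r : r \in O1 -> r < n. Proof. by rewrite -mem_O10 => ->. Qed.

Lemma mem_O1 r : r < n -> (r \in O1) = (r \notin O0).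
Proof.
rewrite -mem_O10; have := O10_uniq; rewrite cat_uniq => /and3P[_ /hasPn D _].
case: (boolP (r \in O0)) => [/D/negbTE ->|_]; by rewrite ?orbF.
Qed.

Lemma shift_pred : shift (n - 1) = m - 1.
Proof. by rewrite /shift (_ : n - 1 + m = m - 1 + n) ?modnDr ?modn_small; lia. Qed.

Lemma OlistP a c : a < n -> c < n ->
  exists2 s, Olist n m a c = a :: s & fpath shift a s /\ last a s = c.
Proof.
move=> lt_a lt_c; rewrite OlistE //; set T := traject shift a n.
have inT : c \in T by exact: mem_traject_shift.
have TE : T = a :: behead T by rewrite /T; case: (n) n_gt0.
have fT : fpath shift a (behead T).
  by rewrite /T; case: (n) n_gt0 => //= k _; exact: fpath_traject.
exists (take (index c T) (behead T)); first by rewrite {2}TE /=.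
split; first by have := fT; rewrite -{1}(cat_take_drop (index c T) (behead T)) cat_path => /andP[].
have sz : size (take (index c T) (behead T)) = index c T.
  rewrite size_takel //; move: inT; rewrite -index_mem size_behead.
  by case: (size T).
rewrite (last_nth 0) sz -[RHS](nth_index 0 inT) -(@nth_take (index c T).+1 _ 0 _ _ T) //.
by rewrite -/(take _.+1 (a :: behead T)) -TE.
Qed.

Lemma O0P : exists2 s, O0 = (m - 1) :: s & fpath shift (m - 1) s /\ last (m - 1) s = 0.
Proof. by apply: OlistP; lia. Qed.
Lemma O1P : exists2 s, O1 = m :: s & fpath shift m s /\ last m s = n - 1.
Proof. by apply: OlistP; lia. Qed.

Lemma mem_pred_O0 : m - 1 \in O0. Proof. by case: O0P => s -> _; exact: mem_head. Qed.
Lemma mem_m_O1 : m \in O1. Proof. by case: O1P => s -> _; exact: mem_head. Qed.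
Lemma mem_0_O0 : 0 \in O0. Proof. by case: O0P => s -> [_ E]; rewrite -[X in X \in _]E mem_last. Qed.
Lemma mem_n_O1 : n - 1 \in O1. Proof. by case: O1P => s -> [_ <-]; exact: mem_last. Qed.

Lemma fpath_closed (f : nat -> nat) a s x :
  fpath f a s -> x \in a :: s -> x != last a s -> f x \in a :: s.
Proof.
elim: s a => [|y s IH] a /=; first by rewrite inE => _ /eqP->; rewrite eqxx.
case/andP=> /eqP Ea pys; rewrite inE => /predU1P[->|xs] nl.
  by rewrite Ea !inE eqxx orbT.
by rewrite inE IH ?orbT.
Qed.

Lemma fpath_ind (f : nat -> nat) (P : nat -> Prop) a s :
  uniq (a :: s) -> fpath f a s -> P a ->
  (forall r, r \in a :: s -> r != last a s -> P r -> P (f r)) ->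
  forall r, r \in a :: s -> P r.
Proof.
elim: s a => [|y s IH] a; first by move=> _ _ Pa _ r; rewrite inE => /eqP->.
move=> /= /andP[na uys] /andP[/eqP Ea pys] Pa step r.
rewrite inE => /predU1P[->//|rys].
have anl : a != last y s by apply: contraNneq na => ->; exact: mem_last.
have Py : P y by rewrite -Ea; apply: step; rewrite ?mem_head.
apply: (IH y) => // r' r'in r'nl; apply: step => //.
by rewrite inE r'in orbT.
Qed.

Lemma O0_ind (P : nat -> Prop) : P (m - 1) ->
  (forall r, r \in O0 -> r != 0 -> P r -> P (shift r)) -> forall r, r \in O0 -> P r.
Proof.
have := O0_uniq; case: O0P => s -> [ps ls] us Pm stp.
by apply: (fpath_ind us ps Pm) => r; rewrite ls; apply: stp.
Qed.

Lemma O1_ind (P : nat -> Prop) : P m ->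
  (forall r, r \in O1 -> r != n - 1 -> P r -> P (shift r)) -> forall r, r \in O1 -> P r.
Proof.
have := O1_uniq; case: O1P => s -> [ps ls] us Pm stp.
by apply: (fpath_ind us ps Pm) => r; rewrite ls; apply: stp.
Qed.

(** A list can be left only from its last edge, [0] for [O0] and [n - 1] for [O1]. *)
Lemma shift_O0 r : r < n -> r != 0 -> r != n - 1 -> (shift r \in O0) = (r \in O0).
Proof.
move=> lt_r r0 rn; apply/idP/idP; last first.
  by case: O0P => s -> [ps ls] rin; apply: (fpath_closed ps) => //; rewrite ls.
apply: contraLR => rn0; rewrite -mem_O1 ?shift_lt //.
have : r \in O1 by rewrite mem_O1.
by case: O1P => s -> [ps ls] rin; apply: (fpath_closed ps) => //; rewrite ls.
Qed.

End Rotation.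

(** * Symbolic orbits and their data *)

Lemma fcycle_traject (T : eqType) (f : T -> T) c x : fcycle f c -> x \in c ->
  (exists k, traject f x (size c) = seq.rot k c) /\ iter (size c) f x = x.
Proof.
move=> fc /rot_to[k s rotE].
have := fc; rewrite -(rot_cycle k) rotE /= => /fpathE; rewrite size_rcons => sE.
have -> : size c = (size s).+1 by rewrite -(size_rot k) rotE.
split; last by rewrite -[RHS](last_rcons x s x) sE last_traject.
exists k; rewrite rotE /=; congr (_ :: _); move: sE.
by rewrite trajectSr => /rcons_inj[].
Qed.

Definition prevt p i := (i + p.-1) %% p.

Lemma prevtK p i : i < p -> prevt p (i.+1 %% p) = i.
Proof.
move=> lt_ip; rewrite /prevt modnDml addSn -addnS prednK ?modnDr ?modn_small //.
exact: leq_ltn_trans lt_ip.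
Qed.

(* [b i] is the branch used at time [i] and [L] lists the times of one period
   by increasing position on [e_0]; time [0] is the leftmost point. *)
Record core (b : nat -> nat) (L : seq nat) : Prop := Core {
  core_perm : perm_eq L (iota 0 (size L));
  core_size : 1 < size L;
  core_min : nth 0 L 0 = 0;
  core_b0 : b 0 = 0;
  core_bp : b (size L).-1 != 0 }.

Section Symbolic.
Variables n m : nat.
Hypotheses (m_gt0 : 0 < m) (lt_mn : m < n) (co_mn : coprime m n).
Variables (b : nat -> nat) (L : seq nat).
Local Notation p := (size L).
Local Notation O0 := (O0 n m).
Local Notation O1 := (O1 n m).

(** Branch 0 enters at [e_{m-1}] and runs along [O0] only; the other branches enter at [e_m] and run
    along [O1] first. So the previous branch tells whether time [i] is seen on the edges of [O1]. *)
Definition via1 i := b (prevt p i) != 0.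
Definition edge r := if r \in O0 then L else [seq i <- L | via1 i].
Definition state x := (x.1 < n) && (x.2 \in edge x.1).
Definition step x :=
  if x.1 == 0 then (if b x.2 == 0 then m - 1 else m, x.2.+1 %% p)
  else (shift n m x.1, x.2).
Definition lab x := (x.1, index x.2 (edge x.1)).
Definition unlab y := (y.1, nth 0 (edge y.1) y.2).
(** Time [p.-1] gets the label [C]: its image is the leftmost point, where the retraction folds the
    truncated map. Elsewhere the label is the sign of the slope, and only branch 1 reverses. Labels
    are ranks on an edge, hence the conjugation of [step] by [lab]. *)
Definition mkdata :=
  let N := [seq size (edge r) | r <- iota 0 n] in
  Data N
    (fun y => if is_label N y then lab (step (unlab y)) else y)
    (fun s => [&& s < p, b (nth 0 L s) == 1 & nth 0 L s != p.-1])
    (fun s => [&& s < p, b (nth 0 L s) != 1 & nth 0 L s != p.-1])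
    (fun s => (s < p) && (nth 0 L s == p.-1)).

Lemma nth_dN r : r < n -> nth 0 (dN mkdata) r = size (edge r).
Proof. by move=> lt_r; rewrite (nth_map 0) ?size_iota // nth_iota. Qed.

Lemma labelE y : is_label (dN mkdata) y = (y.1 < n) && (y.2 < size (edge y.1)).
Proof.
rewrite /is_label size_map size_iota; case: ltnP => //= lt_r.
by rewrite nth_dN.
Qed.

Lemma lab_label x : state x -> is_label (dN mkdata) (lab x).
Proof. by rewrite labelE /state /= index_mem. Qed.

Lemma unlab_state y : is_label (dN mkdata) y -> state (unlab y).
Proof. by rewrite labelE /state /= => /andP[-> lt_s]; exact: mem_nth. Qed.

Lemma labK x : state x -> unlab (lab x) = x.
Proof. by case: x => r i /andP[_ /= iE]; rewrite /unlab /= nth_index. Qed.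

Hypothesis coreL : core b L.
Let p_gt0 : 0 < p. Proof. exact: ltnW (core_size coreL). Qed.

Lemma L_uniq : uniq L.
Proof. by rewrite (perm_uniq (core_perm coreL)) iota_uniq. Qed.

Lemma mem_L i : (i \in L) = (i < p).
Proof. by rewrite (perm_mem (core_perm coreL)) mem_iota. Qed.

Lemma edge_uniq r : uniq (edge r).
Proof. by rewrite /edge; case: ifP => _; rewrite ?filter_uniq ?L_uniq. Qed.

Lemma mem_edge r i : (i \in edge r) = (i < p) && ((r \in O0) || via1 i).
Proof.
rewrite /edge; case: ifP => _; rewrite ?mem_filter mem_L /= ?andbT //.
by rewrite andbC.
Qed.

Lemma unlabK y : is_label (dN mkdata) y -> lab (unlab y) = y.
Proof.
case: y => r s; rewrite labelE /= => /andP[_ lt_s].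
by rewrite /lab /= index_uniq ?edge_uniq.
Qed.

Lemma dpi_lab x : state x -> dpi mkdata (lab x) = lab (step x).
Proof. by move=> sx; rewrite -[in RHS](labK sx) /= -/(dN mkdata) lab_label. Qed.

Lemma edge_shift r : r < n -> r != 0 -> r != n - 1 -> edge (shift n m r) = edge r.
Proof. by move=> lt r0 rn; rewrite /edge shift_O0. Qed.

Lemma step_state x : state x -> state (step x).
Proof.
case: x => r i; rewrite /state /step /= !mem_edge => /and3P[lt_r lt_i iE].
case: eqP => [r0|/eqP r0] /=.
  rewrite ltn_pmod //=; case: eqP iE => [bi0|/eqP bi0] _ /=.
    by rewrite mem_pred_O0 // andbT; lia.
  by rewrite lt_mn /via1 prevtK // bi0 orbT.
rewrite shift_lt // lt_i /=.
have [->|rn] := eqVneq r (n - 1); first by rewrite shift_pred // mem_pred_O0.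
by rewrite shift_O0.
Qed.

Lemma lab_inj : {in state &, injective lab}.
Proof. by move=> x y sx sy E; rewrite -(labK sx) E labK. Qed.

Definition full_cycle : seq (nat * nat) :=
  [seq (r, i) | i <- iota 0 p, r <- if via1 i then O1 ++ O0 else O0].

Lemma mem_full_cycle x : (x \in full_cycle) = state x.
Proof.
case: x => r i; apply/allpairsPdep/idP => [[i' [r' [i'in r'in [-> ->]]]]|].
  move: i'in r'in; rewrite mem_iota /state /= mem_edge => ->.
  case: ifP => _; rewrite ?mem_cat ?mem_O10 ?orbT ?andbT // => r'in.
  by rewrite r'in (O0_lt m_gt0 lt_mn co_mn).
rewrite /state /= mem_edge => /and3P[lt_r lt_i riE].
exists i, r; rewrite mem_iota lt_i; split => //.
by case: ifP riE => _; rewrite ?mem_cat ?mem_O10 ?orbF.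
Qed.

Lemma full_cycle_uniq : uniq full_cycle.
Proof.
apply: allpairs_uniq_dep; rewrite ?iota_uniq //.
  by move=> i _; case: ifP => _; rewrite ?O10_uniq ?O0_uniq.
by move=> [i r] [i' r'] _ _ /= [-> ->].
Qed.

(** Counting the points by time or by edge identifies the period of [step] with [sumn (dN mkdata)],
    the exponent used in [cyc] and [bwd]. *)
Lemma perm_full_cycle : perm_eq full_cycle [seq (r, i) | r <- iota 0 n, i <- edge r].
Proof.
apply: uniq_perm; first exact: full_cycle_uniq.
  apply: allpairs_uniq_dep; rewrite ?iota_uniq //; first by move=> r _; exact: edge_uniq.
  by move=> [i r] [i' r'] _ _ /= [-> ->].
move=> [r i]; rewrite mem_full_cycle; apply/idP/allpairsPdep.
  by case/andP=> /= lt_r iE; exists r, i; rewrite mem_iota.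
by case=> r' [i' [r'in i'in [-> ->]]]; rewrite /state /= i'in andbT; rewrite mem_iota in r'in.
Qed.

Lemma size_full_cycle : size full_cycle = sumn (dN mkdata).
Proof. by rewrite (perm_size perm_full_cycle) size_allpairs_dep. Qed.

Lemma fpath_step i a s : uniq (a :: s) -> fpath (shift n m) a s -> last a s = 0 ->
  fpath step (a, i) [seq (r, i) | r <- s].
Proof.
elim: s a => //= y s IHs a /andP[na us] /andP[/eqP aE ps] ls.
rewrite IHs // andbT /step /= aE ifN //.
by apply: contraNneq na => ->; rewrite -ls mem_last.
Qed.

(** The row of time [i] ends on edge 0, and [step] goes from there to the head of the next row: this
    head is [m] or [m - 1] according to the branch at time [i], which is what [via1] tests. *)
Lemma full_cycle_cycle : fcycle step full_cycle.
Proof.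
pose rows i := if via1 i then O1 ++ O0 else O0.
have rowsP i : exists2 s, rows i = (if via1 i then m else m - 1) :: s
    & fpath step (if via1 i then m else m - 1, i) [seq (r, i) | r <- s]
      /\ last (if via1 i then m else m - 1) s = 0.
  rewrite /rows; case: ifP => _.
    have := last_traject_shift lt_mn; have := O10_uniq m_gt0 lt_mn co_mn.
    have -> : O1 ++ O0 = m :: traject (shift n m) (shift n m m) n.-1.
      by rewrite -O1_O0 //; case: (n) lt_mn.
    have -> : traject (shift n m) m n = m :: traject (shift n m) (shift n m m) n.-1.
      by case: (n) lt_mn.
    move=> us ls; exists (traject (shift n m) (shift n m m) n.-1) => //.
    by split=> //; apply: fpath_step => //; exact: fpath_traject.
  have := O0_uniq m_gt0 lt_mn co_mn; case: (O0P m_gt0 lt_mn co_mn) => s -> [ps ls] us.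
  by exists s => //; split=> //; apply: fpath_step.
have blockE i0 : i0.+1 %% p < p by rewrite ltn_pmod.
(* The path starts at [(0, i0)], the end of the preceding row, so that rows can be chained by
   induction; with [i0 = p.-1] and [p] rows it closes up. *)
have path_blocks k i0 : i0 < p ->
    fpath step (0, i0) (flatten [seq [seq (r, i) | r <- rows i] | i <- traject (fun i => i.+1 %% p) (i0.+1 %% p) k])
    /\ last (0, i0) (flatten [seq [seq (r, i) | r <- rows i] | i <- traject (fun i => i.+1 %% p) (i0.+1 %% p) k]) = (0, iter k (fun i => i.+1 %% p) i0).
  elim: k i0 => [//|k IHk] i0 lt_i0; rewrite iterSr.
  have [ihp ihl] := IHk _ (blockE i0).
  have [s sE [ps ls]] := rowsP (i0.+1 %% p).
  rewrite [traject _ _ _]/= map_cons [flatten _]/= sE map_cons cat_cons /= cat_path last_cat.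
  rewrite (last_map (fun r => (r, i0.+1 %% p))) ls ps ihp ihl; split=> //; rewrite andbT.
  by rewrite /step /= /via1 prevtK // if_neg eqxx.
have iotaE : iota 0 p = traject (fun i => i.+1 %% p) (p.-1.+1 %% p) p.
  have E k : k <= p -> iter k (fun i => i.+1 %% p) 0 = k %% p.
    elim: k => [|k IHk] lt_k; first by rewrite mod0n.
    by rewrite iterS IHk 1?ltnW // -addn1 modnDml addn1.
  rewrite prednK // modnn; apply: (@eq_from_nth _ 0); rewrite ?size_traject ?size_iota // => i lt_i.
  by rewrite nth_iota // nth_traject0 // E ?modn_small // ltnW.
have lt_p1 : p.-1 < p by rewrite prednK.
have [] := path_blocks p p.-1 lt_p1.
rewrite -iotaE -/full_cycle.
case: full_cycle => // x c; rewrite /= => /andP[/eqP E pc] lc.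
have {}lc : last x c = (0, p.-1).
  rewrite lc; congr (_, _).
  have E' k : iter k (fun i => i.+1 %% p) p.-1 = (p.-1 + k) %% p.
    elim: k => [|k IHk]; first by rewrite addn0 modn_small.
    by rewrite iterS IHk -addn1 modnDml addn1 addnS.
  by rewrite E' modnDr modn_small.
by rewrite rcons_path pc lc /= E.
Qed.

Definition label_cycle := map lab full_cycle.

Lemma mem_label_cycle y : (y \in label_cycle) = is_label (dN mkdata) y.
Proof.
apply/mapP/idP => [[x xin ->]|yl]; first by rewrite lab_label -?mem_full_cycle.
by exists (unlab y); rewrite ?unlabK // mem_full_cycle unlab_state.
Qed.

Lemma label_cycle_uniq : uniq label_cycle.
Proof.
rewrite map_inj_in_uniq ?full_cycle_uniq // => x y; rewrite !mem_full_cycle.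
exact: lab_inj.
Qed.

Lemma label_cycle_cycle : fcycle (dpi mkdata) label_cycle.
Proof.
rewrite cycle_map; have := full_cycle_cycle; apply: sub_in_cycle (allss _).
by move=> x y; rewrite mem_full_cycle => sx _ /eqP <- /=; rewrite -(dpi_lab sx) /=.
Qed.

Lemma size_label_cycle : size label_cycle = sumn (dN mkdata).
Proof. by rewrite size_map size_full_cycle. Qed.

Lemma dpi_label y : is_label (dN mkdata) y -> is_label (dN mkdata) (dpi mkdata y).
Proof. by move=> yl; rewrite -(unlabK yl) dpi_lab ?lab_label ?step_state ?unlab_state. Qed.

Lemma state_00 : state (0, 0).
Proof. by rewrite /state /= mem_edge mem_0_O0 // p_gt0 (leq_ltn_trans _ lt_mn). Qed.

Lemma lab_00 : lab (0, 0) = (0, 0).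
Proof.
rewrite /lab /edge /= mem_0_O0 //; congr (_, _).
by rewrite -{1}(core_min coreL) index_uniq // L_uniq.
Qed.

End Symbolic.

(** * The map phi on symbolic orbits *)

(** [cyc] starts at [(0, 0)] and [label_cycle] at the head of a row; [count], and [next] on a
    duplicate-free list, do not see this rotation. *)
Lemma flatten_map_rot (T U : Type) (h : T -> seq U) k (s : seq T) :
  exists k', flatten (map h (seq.rot k s)) = seq.rot k' (flatten (map h s)).
Proof.
exists (size (flatten (map h (take k s)))).
rewrite -{3}(cat_take_drop k s) map_cat flatten_cat rot_size_cat.
by rewrite map_cat flatten_cat.
Qed.

Section Phi.
Variables (b : nat -> nat) (L : seq nat).
Hypothesis coreL : core b L.
Local Notation p := (size L).
Let p_gt0 : 0 < p. Proof. exact: ltnW (core_size coreL). Qed.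

Lemma half_co : coprime 1 2. Proof. by []. Qed.
Lemma half_lt : 1 < 2. Proof. by []. Qed.
Local Notation mkdata2 := (mkdata 2 1 b L).

Variables n m : nat.
Hypotheses (m_gt0 : 0 < m) (lt_mn : m < n) (co_mn : coprime m n).

Lemma edge_half1 : edge 2 1 b L 1 = [seq i <- L | via1 b L i]. Proof. by []. Qed.

(** All edges of [O0] carry the same list of times, so the rank of a time is constant along the
    string. *)
Lemma expand_lab0 i :
  expand n m (lab 2 1 b L (0, i)) = map (lab n m b L) [seq (r, i) | r <- O0 n m].
Proof.
rewrite /expand /= -map_comp; apply/eq_in_map => r r0.
by rewrite /lab /= /edge r0.
Qed.

Lemma expand_lab1 i :
  expand n m (lab 2 1 b L (1, i)) = map (lab n m b L) [seq (r, i) | r <- O1 n m].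
Proof.
rewrite /expand /= -map_comp; apply/eq_in_map => r r1.
by rewrite /lab /= /edge -[r \in O0 n m]negbK -mem_O1 // ?r1 //; exact: O1_lt r1.
Qed.

Lemma flatten_expand_label_cycle :
  flatten [seq expand n m y | y <- label_cycle 2 1 b L] = label_cycle n m b L.
Proof.
rewrite /label_cycle /full_cycle; elim: (iota 0 p) => //= i l IHl.
rewrite !map_cat flatten_cat IHl; congr (_ ++ _).
case: ifP => _.
  rewrite (_ : [seq (r, i) | r <- O1 2 1 ++ O0 2 1] = [:: (1, i); (0, i)]) //.
  rewrite -[LHS]/(expand n m (lab 2 1 b L (1, i)) ++ (expand n m (lab 2 1 b L (0, i)) ++ [::])).
  by rewrite cats0 expand_lab0 expand_lab1 !map_cat.
rewrite (_ : [seq (r, i) | r <- O0 2 1] = [:: (0, i)]) //.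
rewrite -[LHS]/(expand n m (lab 2 1 b L (0, i)) ++ [::]).
by rewrite cats0 expand_lab0.
Qed.

Lemma flatten_expand_cyc : exists k,
  flatten [seq expand n m y | y <- cyc mkdata2] = seq.rot k (label_cycle n m b L).
Proof.
have fc := label_cycle_cycle (ltnSn 0) half_lt half_co coreL.
have in00 : (0, 0) \in label_cycle 2 1 b L.
  by rewrite mem_label_cycle // -(lab_00 (ltnSn 0) half_lt half_co coreL) lab_label // state_00.
have [[k cycE] _] := fcycle_traject fc in00.
have [k' E] := flatten_map_rot (expand n m) k (label_cycle 2 1 b L).
by exists k'; rewrite /cyc -size_label_cycle // cycE E flatten_expand_label_cycle.
Qed.

Lemma count_label_cycle r : r < n ->
  count (fun y => y.1 == r) (label_cycle n m b L) = size (edge n m b L r).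
Proof.
move=> lt_r; rewrite /label_cycle count_map -size_filter.
rewrite -(size_map (pair r) (edge n m b L r)); apply: perm_size; apply: uniq_perm.
- by rewrite filter_uniq // full_cycle_uniq.
- by rewrite map_inj_uniq ?edge_uniq // => i j [].
move=> [r' i]; rewrite mem_filter mem_full_cycle // /state /=.
apply/andP/mapP => [[/eqP-> /andP[_ iE]]|[j jE [-> ->]]]; first by exists i.
by rewrite eqxx lt_r.
Qed.

Lemma phi_mkdata : phi n m mkdata2 = mkdata n m b L.
Proof.
rewrite /phi; have [k ->] := flatten_expand_cyc; rewrite /mkdata; congr Data.
  apply/eq_in_map => r; rewrite mem_iota /= => lt_r.
  by rewrite -count_label_cycle //; apply/permP; rewrite perm_rot.
rewrite -/(dN (mkdata n m b L)).
apply: funext => y; rewrite next_rot ?label_cycle_uniq //.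
(* Off the labels [next] is the identity, which agrees with the normalisation of [dpi]. *)
case: ifP => yl; last by rewrite next_nth mem_label_cycle // yl.
have := label_cycle_cycle m_gt0 lt_mn co_mn coreL.
rewrite -(mem_label_cycle m_gt0 lt_mn co_mn coreL) in yl.
move=> /next_cycle/(_ yl)/eqP <-.
by rewrite mem_label_cycle // in yl; rewrite /= -/(dN (mkdata n m b L)) yl.
Qed.

(* Recovers the data on the 2-star: [phi] is injective because it has a left inverse. *)
Definition unphi (d : data) : data :=
  let N := [:: nth 0 (dN d) 0; nth 0 (dN d) m] in
  Data N
    (fun y => if is_label N y then
       if y.1 == 0 then ((dpi d y).1 == m : nat, (dpi d y).2)
       else (0, (dpi d (n - 1, y.2)).2)
     else y)
    (dA d) (dB d) (dC d).

Lemma edge0 : edge n m b L 0 = L. Proof. by rewrite /edge mem_0_O0. Qed.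
Lemma edge_pred : edge n m b L (m - 1) = L. Proof. by rewrite /edge mem_pred_O0. Qed.
Lemma edge_O1 r : r \in O1 n m -> edge n m b L r = [seq i <- L | via1 b L i].
Proof. by move=> r1; rewrite /edge -[r \in O0 n m]negbK -mem_O1 ?r1 // (O1_lt _ _ _ r1). Qed.

Lemma dpi0 s : s < p -> let i := nth 0 L s in
  dpi (mkdata n m b L) (0, s) =
  if b i == 0 then (m - 1, index (i.+1 %% p) L)
  else (m, index (i.+1 %% p) [seq i <- L | via1 b L i]).
Proof.
move=> lt_s; rewrite /= -/(dN (mkdata n m b L)) labelE /= edge0 lt_s andbT.
rewrite (leq_ltn_trans _ lt_mn) // /unlab /= edge0 /step /= /lab.
by case: eqP => _ /=; rewrite ?edge_pred // edge_O1 // mem_m_O1.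
Qed.

Lemma dpi_pred s : s < size [seq i <- L | via1 b L i] ->
  dpi (mkdata n m b L) (n - 1, s) =
  (m - 1, index (nth 0 [seq i <- L | via1 b L i] s) L).
Proof.
have n1 := mem_n_O1 m_gt0 lt_mn co_mn.
move=> lt_s; rewrite /= -/(dN (mkdata n m b L)) labelE /= edge_O1 // lt_s andbT.
rewrite (O1_lt m_gt0 lt_mn co_mn n1) /unlab /= edge_O1 // /step /= ifN; last lia.
by rewrite /lab /= shift_pred // edge_pred.
Qed.

End Phi.

Section Unphi.
Variables (b : nat -> nat) (L : seq nat).
Hypothesis coreL : core b L.
Variables n m : nat.
Hypotheses (m_gt0 : 0 < m) (lt_mn : m < n) (co_mn : coprime m n).

(** Edge 1 of the 2-star is recovered from the two ends of [O1]: its size from [e_m], its images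
    from [e_{n-1}], which rotates onto [e_{m-1}], where ranks are those of [e_0]. *)
Lemma unphi_mkdata : unphi n m (mkdata n m b L) = mkdata 2 1 b L.
Proof.
have n_gt0 : 0 < n by exact: leq_ltn_trans lt_mn.
have NE : [:: nth 0 (dN (mkdata n m b L)) 0; nth 0 (dN (mkdata n m b L)) m] = dN (mkdata 2 1 b L).
  by rewrite !nth_dN // edge0 // edge_O1 ?mem_m_O1.
transitivity (let d := mkdata 2 1 b L in Data (dN d) (dpi d) (dA d) (dB d) (dC d)); last by [].
rewrite /unphi; congr Data => //; rewrite NE.
apply: funext => -[r s]; case: ifP => yl; last by rewrite [RHS]/= -/(dN (mkdata 2 1 b L)) yl.
have := yl; rewrite labelE => /andP[].
case: r yl => [|[|//]] yl _ lt_s.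
  rewrite [RHS](@dpi0 b L 2 1 (ltnSn 0) half_lt half_co) // [_ == 0]/= dpi0 //.
  case: (b (nth 0 L s) == 0) => /=; last by rewrite eqxx.
  by rewrite (_ : (m - 1 == m) = false) //; lia.
rewrite [RHS](@dpi_pred b L coreL 2 1 (ltnSn 0) half_lt half_co _ lt_s).
transitivity (0, (dpi (mkdata n m b L) (n - 1, s)).2); first by [].
by rewrite dpi_pred.
Qed.

End Unphi.

(** * The colouring *)

(* The colouring [col] propagates backwards from [(m, 0)] and stops when it
   would reach [(0, 0)], the last of the points [(r, 0)]. *)
Inductive colored (d : data) (m : nat) : nat * nat -> bool -> Prop :=
| colored_first y : is_label (dN d) y -> dpi d y = (m, 0) -> colored d m y true
| colored_back y c : is_label (dN d) y -> y != (0, 0) -> colored d m (dpi d y) c ->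
    colored d m y (if (y.1 == 0) && dA d y.2 then ~~ c else c).

Lemma fpath_rind (f : nat -> nat) (P : nat -> Prop) a s :
  uniq (a :: s) -> fpath f a s -> P (last a s) ->
  (forall r, r \in a :: s -> r != last a s -> P (f r) -> P r) ->
  forall r, r \in a :: s -> P r.
Proof.
elim: s a => [|y s IH] a; first by move=> _ _ Pa _ r; rewrite inE => /eqP->.
move=> /= /andP[na uys] /andP[/eqP Ea pys] Pl stp.
have anl : a != last y s by apply: contraNneq na => ->; exact: mem_last.
have Pys : forall r, r \in y :: s -> P r.
  by apply: IH => // r rin rnl; apply: stp => //; rewrite inE rin orbT.
move=> r; rewrite inE => /predU1P[->|]; last exact: Pys.
by apply: stp; rewrite ?mem_head // Ea; apply: Pys; exact: mem_head.
Qed.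

Section ColoredCol.
Variables n m : nat.
Hypotheses (m_gt0 : 0 < m) (lt_mn : m < n) (co_mn : coprime m n).
Variables (b : nat -> nat) (L : seq nat).
Hypothesis coreL : core b L.
Local Notation d := (mkdata n m b L).
Local Notation T := (sumn (dN d)).

Lemma via10 : via1 b L 0.
Proof.
rewrite /via1 /prevt add0n modn_small; first exact: (core_bp coreL).
by have := core_size coreL; case: (size L).
Qed.

Lemma mem_edge_0 r : 0 \in edge n m b L r.
Proof. by rewrite mem_edge // via10 orbT (ltnW (core_size coreL)). Qed.

Lemma lab_r0 r : lab n m b L (r, 0) = (r, 0).
Proof.
have v0 := via10; rewrite /lab /edge /=; set P := via1 b L in v0 *.
have -> : L = 0 :: behead L.
  by rewrite -[in RHS](core_min coreL); case: (L) (core_size coreL).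
by case: ifP => _ //=; rewrite v0.
Qed.

Lemma label_r0 r : r < n -> is_label (dN d) (r, 0).
Proof. by move=> lt_r; rewrite -lab_r0 lab_label // /state /= lt_r mem_edge_0. Qed.

Lemma iter_dpi k x : state n m b L x ->
  iter k (dpi d) (lab n m b L x) = lab n m b L (iter k (step n m b L) x) /\
  state n m b L (iter k (step n m b L) x).
Proof.
move=> sx; elim: k => [//|k [IH IHs]]; rewrite !iterS IH dpi_lab //; split=> //.
exact: step_state.
Qed.

(** The points [(r, 0)] are [n] consecutive points of the orbit, from [(m, 0)] to [(0, 0)].
    Backwards from [(m, 0)] all other points come first, at exponents [1] to [T - n], the range of
    the colouring. *)
Lemma iter_dpi_m0 : iter n.-1 (dpi d) (m, 0) = (0, 0).
Proof.
rewrite -(lab_r0 m) (proj1 (iter_dpi _ _)); last by rewrite /state /= lt_mn mem_edge_0.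
have us := traject_shift_uniq m_gt0 lt_mn co_mn lt_mn; have ls := last_traject_shift lt_mn.
have TE : traject (shift n m) m n = m :: traject (shift n m) (shift n m m) n.-1.
  by case: (n) lt_mn.
rewrite TE in us ls.
have := @fpath_step n m b L 0 _ _ us (fpath_traject _ _ _) ls.
move=> /fpathE; rewrite size_map size_traject => /(congr1 (last (m, 0))).
rewrite last_traject => <-; rewrite (last_map (fun r => (r, 0))) [last _ _]ls.
exact: lab_r0.
Qed.

Lemma iter_period : iter T (dpi d) (m, 0) = (m, 0).
Proof.
rewrite -(size_label_cycle m_gt0 lt_mn co_mn coreL).
by apply: (fcycle_traject (label_cycle_cycle _ _ _ _) _).2; rewrite ?mem_label_cycle ?label_r0.
Qed.

Lemma iter_surj y : is_label (dN d) y -> exists2 j, j < T & y = iter j (dpi d) (m, 0).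
Proof.
rewrite -(mem_label_cycle m_gt0 lt_mn co_mn coreL) => yin; apply/trajectP.
have [|[k E] _] := @fcycle_traject _ _ _ (m, 0) (label_cycle_cycle m_gt0 lt_mn co_mn coreL).
  by rewrite mem_label_cycle ?label_r0.
by rewrite -size_label_cycle // E mem_rot.
Qed.

Lemma iter_inj i j : i < T -> j < T ->
  iter i (dpi d) (m, 0) = iter j (dpi d) (m, 0) -> i = j.
Proof.
have [|[k E] _] := @fcycle_traject _ _ _ (m, 0) (label_cycle_cycle m_gt0 lt_mn co_mn coreL).
  by rewrite mem_label_cycle ?label_r0.
have := label_cycle_uniq m_gt0 lt_mn co_mn coreL; rewrite -(rot_uniq k) -E size_label_cycle //.
move=> /(uniqP (m, 0)) inj lti ltj; rewrite -!(nth_traject _ (n := T)) // => /inj.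
by apply; rewrite inE size_traject.
Qed.

Lemma iter_label k : is_label (dN d) (iter k (dpi d) (m, 0)).
Proof. by elim: k => [|k IH]; [exact: label_r0|exact: dpi_label]. Qed.

Lemma lt_nT : n < T.
Proof.
rewrite -(size_label_cycle m_gt0 lt_mn co_mn coreL).
have -> : n.+1 = size ((0, 1) :: [seq (r, 0) | r <- iota 0 n]) by rewrite /= size_map size_iota.
apply: uniq_leq_size.
  rewrite /= map_inj_uniq ?iota_uniq ?andbT => [|? ? []] //.
  by apply/negP => /mapP[].
move=> y; rewrite inE mem_label_cycle // => /predU1P[->|/mapP[r]].
  by rewrite labelE /= edge0 // (core_size coreL) andbT (leq_ltn_trans _ lt_mn).
by rewrite mem_iota => lt_r ->; exact: label_r0.
Qed.

(** Eliminating the exponent turns the colour into an inductive predicate, which can be compared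
    between stars whose orbits have different periods. Injectivity of the iterates over one period
    recovers the exponent. *)
Lemma coloredP y c :
  (exists i, [/\ 1 <= i <= T - n, bwd d m i = y & Defs.col d m i = c]) <-> colored d m y c.
Proof.
have ltnT := lt_nT; split.
  case=> i; elim: i y c => [|i IHi] y c; first by case=> /andP[].
  have [-> [_ <- <-]|i0] := posnP i.
    apply: colored_first; first exact: iter_label.
    rewrite /bwd -iterS subn1 prednK ?iter_period //; lia.
  case=> lei yE cE.
  have piy : dpi d y = bwd d m i.
    by rewrite -yE /bwd -iterS (_ : (T - i.+1).+1 = T - i) //; lia.
  have -> : c = if (y.1 == 0) && dA d y.2 then ~~ Defs.col d m i else Defs.col d m i.
    by rewrite -cE -yE; case: (i) i0.
  apply: colored_back; first by rewrite -yE; exact: iter_label.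
    apply/eqP => y0; move: yE; rewrite y0 -iter_dpi_m0 /bwd => yE.
    have : T - i.+1 = n.-1 by apply: iter_inj => //; lia.
    lia.
  by rewrite piy; apply: IHi; split=> //; lia.
elim=> {y c} [y yl yE|y c yl yn0 _ [i [lei iE cE]]].
  exists 1; split=> //; first lia.
  have [j ltj jE] := iter_surj yl.
  rewrite jE -iterS in yE; rewrite jE /bwd; congr (iter _ _ _).
  case: (ltngtP j.+1 T) => [ltj1|| ]; [|lia|lia].
  suff : j.+1 = 0 by []. by apply: iter_inj => //; lia.
have [j ltj jE] := iter_surj yl.
have jiE : j = T - i.+1.
  move: iE; rewrite /bwd jE -iterS => /esym E.
  case: (ltngtP j.+1 T) => [ltj1|| jT]; [|lia|].
    have : j.+1 = T - i by apply: iter_inj => //; lia.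
    lia.
  rewrite jT iter_period in E.
  have : 0 = T - i by apply: iter_inj => //; lia.
  lia.
(* At [i = T - n] the point before would be [(0, 0)], which [colored_back] forbids. *)
have lt_i : i < T - n.
  case: (ltngtP i (T - n)) => [//|gti|iT]; first lia.
  case/eqP: yn0; rewrite jE -iter_dpi_m0; congr (iter _ _ _); lia.
exists i.+1; split; first lia.
  by rewrite jE jiE.
rewrite -cE; case: i lei iE {cE} jiE lt_i => [//|i] lei iE jiE lt_i.
by rewrite [LHS]/= -/(bwd _ _ _) /bwd -jiE -jE.
Qed.

Lemma in_betaP y : in_beta d n m y <-> colored d m y true.
Proof.
rewrite -coloredP /in_beta; split=> -[i [A B C]]; by exists i; split => //; rewrite C.
Qed.

Lemma in_alphaP y : in_alpha d n m y <-> colored d m y false.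
Proof.
rewrite -coloredP /in_alpha; split=> -[i [A B C]]; exists i; split => //; last by rewrite C.
exact: negbTE.
Qed.

(** Induction from the last edge of the list, the direction in which colours propagate. *)
Lemma O0_rind (P : nat -> Prop) : P 0 ->
  (forall r, r \in O0 n m -> r != 0 -> P (shift n m r) -> P r) ->
  forall r, r \in O0 n m -> P r.
Proof.
have := O0_uniq m_gt0 lt_mn co_mn; case: (O0P m_gt0 lt_mn co_mn) => s -> [ps ls] us Pm stp.
by apply: (fpath_rind us ps); rewrite ls.
Qed.

Lemma O1_rind (P : nat -> Prop) : P (n - 1) ->
  (forall r, r \in O1 n m -> r != n - 1 -> P (shift n m r) -> P r) ->
  forall r, r \in O1 n m -> P r.
Proof.
have := O1_uniq m_gt0 lt_mn co_mn; case: (O1P m_gt0 lt_mn co_mn) => s -> [ps ls] us Pm stp.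
by apply: (fpath_rind us ps); rewrite ls.
Qed.

Lemma dpi_shift r s : is_label (dN d) (r, s) -> r != 0 -> r != n - 1 ->
  dpi d (r, s) = (shift n m r, s).
Proof.
move=> yl r0 rn; rewrite -{1}(unlabK coreL yl) dpi_lab ?unlab_state //.
rewrite /step /= (negbTE r0) /lab /=.
move: yl; rewrite labelE /= => /andP[lt_r lt_s].
by rewrite edge_shift // index_uniq ?edge_uniq.
Qed.

End ColoredCol.

(** * Comparison of the colourings on the two stars *)

Section ColoredTransfer.
Variables (b : nat -> nat) (L : seq nat).
Hypothesis coreL : core b L.
Variables n m : nat.
Hypotheses (m_gt0 : 0 < m) (lt_mn : m < n) (co_mn : coprime m n).
Local Notation d2 := (mkdata 2 1 b L).
Local Notation d' := (mkdata n m b L).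
Local Notation LS := [seq i <- L | via1 b L i].

(** The point of the 2-star whose string under [expand] contains [y]. *)
Definition collapse (y : nat * nat) : nat * nat := (if y.1 \in O0 n m then 0 else 1, y.2).

Lemma dpi_half1 s : s < size LS -> dpi d2 (1, s) = (0, index (nth 0 LS s) L).
Proof. exact: (@dpi_pred b L coreL 2 1 (ltnSn 0) half_lt half_co). Qed.

Lemma label_collapse y : is_label (dN d') y -> is_label (dN d2) (collapse y).
Proof.
case: y => r s; rewrite !labelE /collapse /= => /andP[lt_r].
by rewrite {1}/edge; case: ifP.
Qed.

Lemma O1_notin_O0 r : r \in O1 n m -> (r \in O0 n m) = false.
Proof. by move=> r1; apply/negbTE; rewrite -mem_O1 // (O1_lt m_gt0 lt_mn co_mn r1). Qed.

Lemma collapse_O0 r s : r \in O0 n m -> collapse (r, s) = (0, s).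
Proof. by rewrite /collapse /= => ->. Qed.

Lemma collapse_O1 r s : r \in O1 n m -> collapse (r, s) = (1, s).
Proof. by move/O1_notin_O0; rewrite /collapse /= => ->. Qed.

Lemma collapse_dpi0 s : s < size L -> collapse (dpi d' (0, s)) = dpi d2 (0, s).
Proof.
move=> lt_s; rewrite !dpi0 //; case: (b _ == 0); rewrite /collapse /=.
  by rewrite mem_pred_O0.
by have := mem_m_O1 m_gt0 lt_mn co_mn; rewrite mem_O1 // => /negbTE ->.
Qed.

Lemma collapse_dpi_pred s : s < size LS ->
  collapse (dpi d' (n - 1, s)) = dpi d2 (1, s).
Proof.
move=> lt_s; rewrite dpi_pred // dpi_half1 //.
by rewrite /collapse /= mem_pred_O0.
Qed.

Lemma label_edge0 r s : r \in O0 n m -> is_label (dN d') (r, s) = (s < size L).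
Proof. by move=> r0; rewrite labelE /edge /= r0 (O0_lt m_gt0 lt_mn co_mn r0). Qed.

Lemma label_edge1 r s : r \in O1 n m -> is_label (dN d') (r, s) = (s < size LS).
Proof. by move=> r1; rewrite labelE /= edge_O1 // (O1_lt m_gt0 lt_mn co_mn r1). Qed.

Lemma O1_neq0 r : r \in O1 n m -> r != 0.
Proof. by apply: contraTneq => ->; rewrite mem_O1 ?mem_0_O0 // (leq_ltn_trans _ lt_mn). Qed.

Lemma O0_neq r : r \in O0 n m -> r != n - 1.
Proof.
by apply: contraTneq => ->; rewrite -mem_O1 ?mem_n_O1 //; lia.
Qed.

(** Inside a string neither the colour nor [collapse] changes, since colours flip only on edge 0; at
    the ends [0] and [n - 1] of the strings [collapse] commutes with [dpi]. *)
Lemma colored_collapse y c : colored d' m y c -> colored d2 1 (collapse y) c.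
Proof.
elim=> {y c} [y yl yE|y c yl yn0 _ IH].
  have cl := label_collapse yl; apply: colored_first => //.
  case: y yl yE cl => r s yl yE _.
  (* A preimage of [(m, 0)] is on edge 0: [n - 1] rotates to [m - 1], and the rotation sends no
     [r != 0] to [m]. *)
  have r0 : r = 0.
    apply/eqP; apply: contraT => rn0; have [rn|rn] := eqVneq r (n - 1).
      move: yl yE; rewrite rn label_edge1 ?mem_n_O1 // => lt_s.
      by rewrite dpi_pred // => -[]; lia.
    move: (yE); rewrite (dpi_shift m_gt0 lt_mn co_mn coreL yl rn0 rn) => -[sE s0].
    have : r = 0; last by move/eqP; rewrite (negbTE rn0).
    move: sE; rewrite /shift; have : r < n by move: yl; rewrite labelE => /andP[].
    move=> lt_r; have := divn_eq (r + m) n => E sE; rewrite sE in E.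
    have : r = (r + m) %/ n * n by lia.
    by case: ((r + m) %/ n) => [|k]; rewrite ?mulSn; lia.
  rewrite r0 in yl yE *; rewrite collapse_O0 ?mem_0_O0 // -collapse_dpi0 ?yE.
    by rewrite collapse_O1 ?mem_m_O1.
  by rewrite -(label_edge0 s (mem_0_O0 m_gt0 lt_mn co_mn)).
case: y yl yn0 IH => r s yl yn0 IH.
have cl := label_collapse yl.
have [r0|rn0] := eqVneq r 0.
  move: r0 => -> in yl yn0 IH cl *.
  have lt_s : s < size L by rewrite -(label_edge0 s (mem_0_O0 m_gt0 lt_mn co_mn)).
  rewrite collapse_dpi0 // in IH.
  move: cl; rewrite collapse_O0 ?mem_0_O0 // => cl.
  exact: (colored_back cl yn0 IH).
have [rn|rn] := eqVneq r (n - 1).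
  move: rn => -> in yl yn0 IH cl *.
  have lt_s : s < size LS by rewrite -(label_edge1 s (mem_n_O1 m_gt0 lt_mn co_mn)).
  rewrite collapse_dpi_pred // in IH.
  move: cl; rewrite collapse_O1 ?mem_n_O1 // => cl.
  exact: (colored_back cl isT IH).
by move: IH; rewrite dpi_shift // /collapse /= shift_O0 //; move: yl; rewrite labelE => /andP[].
Qed.

Lemma colored_O0 s c : colored d' m (0, s) c -> forall r, r \in O0 n m -> colored d' m (r, s) c.
Proof.
move=> c0; have lt_s : s < size L.
  by rewrite -(label_edge0 s (mem_0_O0 m_gt0 lt_mn co_mn)); case: c0.
apply: O0_rind => // r r0 rn0 cr.
have yl : is_label (dN d') (r, s) by rewrite label_edge0.
have -> : c = if ((r, s).1 == 0) && dA d' (r, s).2 then ~~ c else c by rewrite (negbTE rn0).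
apply: colored_back => //.
  by apply: contra_neq rn0 => -[].
by rewrite dpi_shift // O0_neq.
Qed.

Lemma colored_O1 s c : colored d' m (n - 1, s) c ->
  forall r, r \in O1 n m -> colored d' m (r, s) c.
Proof.
move=> c0; have lt_s : s < size LS.
  by rewrite -(label_edge1 s (mem_n_O1 m_gt0 lt_mn co_mn)); case: c0.
apply: O1_rind => // r r1 rn cr.
have yl : is_label (dN d') (r, s) by rewrite label_edge1.
have rn0 := O1_neq0 r1.
have -> : c = if ((r, s).1 == 0) && dA d' (r, s).2 then ~~ c else c by rewrite (negbTE rn0).
apply: colored_back => //.
  by apply: contra_neq rn0 => -[].
by rewrite dpi_shift.
Qed.

(** It suffices to colour the last point of each string, because [colored_O0] and [colored_O1]
    spread its colour backwards. In the inductive case the image of that point is the head of the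
    next string, already coloured. *)
Lemma colored_expand y c : colored d2 1 y c ->
  forall r, r < n -> collapse (r, y.2) = y -> colored d' m (r, y.2) c.
Proof.
elim=> {y c} [[a s] yl yE|[a s] c yl yn0 _ IH] r lt_r rE.
  have a0 : a = 0.
    case: a yl yE {rE} => [//|[|//]] yl; move: (yl); rewrite labelE => /andP[_].
    by rewrite edge_half1 => lt_s; rewrite dpi_half1.
  have r0 : r \in O0 n m by move: rE; rewrite a0 /collapse /=; case: (r \in _).
  move: a0 => -> in yl yE {rE}.
  apply: colored_O0 => //; apply: colored_first; first by rewrite label_edge0 ?mem_0_O0.
  have lt_s : s < size L by move: yl; rewrite labelE.
  rewrite dpi0 //=; move: yE; rewrite (@dpi0 b L 2 1 (ltnSn 0) half_lt half_co _ lt_s).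
  by case: (b _ == 0) => // -[->].
case: a yl yn0 IH rE => [|[|//]] yl yn0 IH rE; last first.
  have r1 : r \in O1 n m by move: rE; rewrite /collapse mem_O1 //=; case: (r \in _).
  have lt_s : s < size LS by move: yl; rewrite labelE.
  apply: colored_O1 => //.
  have n1 := mem_n_O1 m_gt0 lt_mn co_mn.
  have yl' : is_label (dN d') (n - 1, s) by rewrite label_edge1.
  have nn0 := O1_neq0 n1.
  have -> : c = if ((n - 1, s).1 == 0) && dA d' (n - 1, s).2 then ~~ c else c by rewrite (negbTE nn0).
  apply: colored_back => //.
    by apply: contra_neq nn0 => -[].
  have E := collapse_dpi_pred lt_s.
  move: IH; rewrite -E dpi_pred // /collapse /= mem_pred_O0 // => /(_ (m - 1)); apply; first lia.
  by rewrite mem_pred_O0.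
have r0 : r \in O0 n m by move: rE; rewrite /collapse /=; case: (r \in _).
have lt_s : s < size L by move: yl; rewrite labelE.
apply: colored_O0 => //.
have yl' : is_label (dN d') (0, s) by rewrite label_edge0 // mem_0_O0.
apply: (colored_back yl' yn0).
have dl := dpi_label m_gt0 lt_mn co_mn coreL yl'.
move: IH; rewrite -collapse_dpi0 //; case: (dpi d' (0, s)) dl => r' s' dl /(_ r').
by apply; move: dl; rewrite labelE => /andP[].
Qed.

Lemma colored_iff y c : is_label (dN d') y ->
  colored d' m y c <-> colored d2 1 (collapse y) c.
Proof.
move=> yl; split; first exact: colored_collapse.
case: y yl => r s yl cc; apply: (colored_expand cc) => //.
by move: yl; rewrite labelE => /andP[].
Qed.

End ColoredTransfer.

(** * Invariance of the conditions defining TT *)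

Section TTTransfer.
Variables (R : realType) (b : nat -> nat) (L : seq nat).
Hypothesis coreL : core b L.
Variables n m : nat.
Hypotheses (m_gt0 : 0 < m) (lt_mn : m < n) (co_mn : coprime m n).

Lemma TTset_iff : Pset R 2 1 0 LB (mkdata 2 1 b L) -> Pset R n m (m - 1) LB (mkdata n m b L) ->
  TTset R 2 1 0 LB (mkdata 2 1 b L) <-> TTset R n m (m - 1) LB (mkdata n m b L).
Proof.
move=> P2 Pn; have n_gt0 : 0 < n by exact: leq_ltn_trans lt_mn.
have p_gt0 : 0 < size L by exact: ltnW (core_size coreL).
have N0 : nth 0 (dN (mkdata n m b L)) 0 = size L by rewrite nth_dN // edge0.
(* The edge [k + n - m] of condition (c) is the last one of [O1]; on the 2-star it is edge 1. *)
have qE : m - 1 + n - m = n - 1 by lia.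
have Nq : nth 0 (dN (mkdata n m b L)) (n - 1) = size [seq i <- L | via1 b L i].
  by rewrite nth_dN ?edge_O1 ?mem_n_O1 //; lia.
have col0 s c : s < size L -> colored (mkdata n m b L) m (dpi (mkdata n m b L) (0, s)) c <->
    colored (mkdata 2 1 b L) 1 (dpi (mkdata 2 1 b L) (0, s)) c.
  move=> lt_s; rewrite -(collapse_dpi0 b m_gt0 lt_mn co_mn lt_s); apply: colored_iff => //.
  by apply: dpi_label => //; rewrite label_edge0 // mem_0_O0.
have colq s c : s < size [seq i <- L | via1 b L i] ->
    colored (mkdata n m b L) m (dpi (mkdata n m b L) (n - 1, s)) c <->
    colored (mkdata 2 1 b L) 1 (dpi (mkdata 2 1 b L) (1, s)) c.
  move=> lt_s; rewrite -(collapse_dpi_pred coreL m_gt0 lt_mn co_mn lt_s); apply: colored_iff => //.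
  by apply: dpi_label => //; rewrite label_edge1 // mem_n_O1.
have p2 s : s < size L ->
    (dpi (mkdata n m b L) (0, s)).2 = (dpi (mkdata 2 1 b L) (0, s)).2.
  by move=> lt_s; rewrite -(collapse_dpi0 b m_gt0 lt_mn co_mn lt_s).
have q2 s : s < size [seq i <- L | via1 b L i] ->
    (dpi (mkdata n m b L) (n - 1, s)).2 = (dpi (mkdata 2 1 b L) (1, s)).2.
  by move=> lt_s; rewrite -(collapse_dpi_pred coreL m_gt0 lt_mn co_mn lt_s).
split=> -[_ Ca _ Cc _]; split=> //.
- move=> s; rewrite N0 => lt_s; have [Cal Cbe] := Ca s lt_s.
  have lt_s' := ltnW lt_s.
  split=> [/Cal|/Cbe].
    by rewrite !in_alphaP // col0.
  by rewrite !in_betaP // col0.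
- by move=> r; lia.
- rewrite qE => s s0; rewrite Nq => lt_s; rewrite p2 // q2 // => lt_pi.
  have := Cc s s0 lt_s lt_pi.
  by rewrite !in_betaP // colq.
- move=> s lt_s; have lt_s' := ltnW lt_s.
  have := Ca s; rewrite N0 => /(_ lt_s)[Cal Cbe].
  split=> [/Cal|/Cbe].
    by rewrite !in_alphaP // col0.
  by rewrite !in_betaP // col0.
- by move=> r; lia.
- move=> s s0 lt_s lt_pi.
  have := Cc s s0; rewrite qE Nq p2 // q2 // => /(_ lt_s lt_pi).
  by rewrite !in_betaP // colq.
Qed.

End TTTransfer.

(** * Itineraries of the first return map *)

Section Itineraries.
Local Open Scope ring_scope.
Variable R : realType.

(* The three branches of the first return map to [e_0] that a star-orbit with
   [p_0] mapped onto [e_{m-1}] can visit: the last subintervals of [e_0],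
   mapped onto [e_{m-1}] (k = 0), backwards onto [e_m] (k = 1) and onto [e_m] (k = 2). *)
Definition branch (m k : nat) (t : R) : R :=
  if k == 1%N then 2 * m%:R - (2 * m%:R + 1) * t
  else (2 * m%:R + 1) * t - (2 * m%:R - 2 + k%:R).

Definition branch_inv (m k : nat) (u : R) : R :=
  if k == 1%N then (2 * m%:R - u) / (2 * m%:R + 1)
  else (u + (2 * m%:R - 2 + k%:R)) / (2 * m%:R + 1).

Record itinerary (m : nat) (b : nat -> nat) (q : nat -> R) : Prop := Itinerary {
  itin_itv : forall i, 0 < q i < 1;
  itin_branch : forall i, (b i <= 2)%N;
  itin_step : forall i, q i.+1 = branch m (b i) (q i) }.

Record model (m p : nat) (b : nat -> nat) (q : nat -> R) : Prop := Model {
  model_itin : itinerary m b q;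
  model_p : (1 < p)%N;
  model_q : forall i, q (i + p)%N = q i;
  model_b : forall i, b (i + p)%N = b i;
  model_inj : forall i j, (i < p)%N -> (j < p)%N -> q i = q j -> i = j;
  model_min : forall i, q 0%N <= q i;
  model_b0 : b 0%N = 0%N;
  model_bp : b p.-1 != 0%N }.

Lemma slope_gt0 m : 0 < 2 * m%:R + 1 :> R.
Proof. by have := ler0n R m; lra. Qed.

Lemma branchK m k : cancel (branch_inv m k) (branch m k).
Proof.
move=> u; have := slope_gt0 m; rewrite /branch /branch_inv; set D := 2 * m%:R + 1 => D0.
have Dn0 : D != 0 by rewrite gt_eqF.
by case: eqP => _; rewrite mulrCA divff // mulr1; ring.
Qed.

Lemma branch_itv m k (t : R) : 0 < branch m k t < 1 ->
  2 * m%:R - 2 + k%:R < (2 * m%:R + 1) * t < 2 * m%:R - 1 + k%:R.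
Proof. by rewrite /branch; case: eqP => [->|_] /andP[? ?]; apply/andP; split; lra. Qed.

Lemma branch_inv_itv m k (u : R) : (0 < m)%N -> (k <= 2)%N -> 0 <= u <= 1 ->
  0 <= branch_inv m k u <= 1.
Proof.
move=> m0 k2 /andP[u0 u1].
have m1 : 1 <= m%:R :> R by rewrite ler1n.
have k0 : 0 <= k%:R :> R by exact: ler0n.
have {}k2 : k%:R <= 2 :> R by rewrite ler_nat.
rewrite /branch_inv; case: ifP => _; rewrite ler_pdivlMr ?ler_pdivrMr ?slope_gt0 //;
  apply/andP; split; lra.
Qed.

(** An endpoint of [0, 1] whose image stays in [0, 1] is fixed by its branch, so an itinerary
    through it is constant; [branch_1] treats the other endpoint. *)
Lemma branch_0 m k : (0 < m)%N -> (k <= 2)%N -> 0 <= branch m k 0 <= 1 ->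
  k = 0%N /\ branch m k 0 = 0.
Proof.
move=> m0; have m1 : 1 <= m%:R :> R by rewrite ler1n.
case: k => [|[|[|//]]] _; rewrite /branch /= mulr0 => /andP[g0 g1].
- by split=> //; lra.
- by exfalso; lra.
- by exfalso; lra.
Qed.

Lemma branch_1 m k : (0 < m)%N -> (k <= 2)%N -> 0 <= branch m k 1 <= 1 ->
  k = 2%N /\ branch m k 1 = 1.
Proof.
move=> m0; have m1 : 1 <= m%:R :> R by rewrite ler1n.
case: k => [|[|[|//]]] _; rewrite /branch /= mulr1 => /andP[g0 g1].
- by exfalso; lra.
- by exfalso; lra.
- by split=> //; lra.
Qed.

(* Points are ordered by their itineraries: expansion separates two points of
   the same branch until they fall in different branches. *)
Lemma itin_lt m m' b (q q' : nat -> R) : (0 < m)%N -> itinerary m b q -> itinerary m' b q' ->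
  forall i j, q i < q j -> q' i < q' j.
Proof.
move=> m0 It It'.
have m1 : 1 <= m%:R :> R by rewrite ler1n.
(* The slope is at least 3, its value for [m = 1]. Points of (0, 1) are less than 1 apart, so a gap
   of at least 3^-N allows fewer than [N] steps on common branches. *)
suff H N : forall i j, q i < q j -> 1 <= (q j - q i) * 3 ^+ N -> q' i < q' j.
  move=> i j lt_ij; have d0 : 0 < q j - q i by rewrite subr_gt0.
  have [N NE] : exists N : nat, (q j - q i)^-1 <= N%:R.
    exists (Num.bound (q j - q i)^-1); rewrite ltW // archi_boundP // invr_ge0 ltW //.
  apply: (H N) => //; rewrite -ler_pdivrMl // mulr1 (le_trans NE) //.
  by rewrite -natrX ler_nat ltnW // ltn_expl.
elim: N => [|N IHN] i j lt_ij; rewrite ?mulr1.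
  by have := itin_itv It i; have := itin_itv It j; lra.
rewrite exprS mulrA => sepN.
have Bi := itin_itv It i.+1; have Bj := itin_itv It j.+1.
have Bi' := itin_itv It' i.+1; have Bj' := itin_itv It' j.+1.
rewrite !(itin_step It) in Bi Bj; rewrite !(itin_step It') in Bi' Bj'.
have /andP[Bi1 Bi2] := branch_itv Bi; have /andP[Bj1 Bj2] := branch_itv Bj.
have /andP[Bi1' Bi2'] := branch_itv Bi'; have /andP[Bj1' Bj2'] := branch_itv Bj'.
have D0 := slope_gt0 m; have D0' := slope_gt0 m'.
(* Subintervals are ordered by branch number, so distinct branches decide; a common branch passes
   the question to the images, swapped on branch 1. *)
case: (ltngtP (b i) (b j)) => [lt_b|lt_b|eq_b].
- have leb : (b i)%:R + 1 <= (b j)%:R :> R by rewrite natr1 ler_nat.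
  by rewrite -(ltr_pM2l D0'); lra.
- have leb : (b j)%:R + 1 <= (b i)%:R :> R by rewrite natr1 ler_nat.
  by move: lt_ij; rewrite -(ltr_pM2l D0); lra.
have X0 : 0 <= (3 : R) ^+ N by apply: exprn_ge0; lra.
have sep : 1 <= (2 * m%:R + 1) * (q j - q i) * 3 ^+ N.
  apply: le_trans sepN _; rewrite ler_wpM2r // mulrC ler_wpM2r //; lra.
have dd0 : 0 < (2 * m%:R + 1) * (q j - q i) by rewrite mulr_gt0 // subr_gt0.
case: (eqVneq (b j) 1%N) => bj.
  have := IHN j.+1 i.+1; rewrite !(itin_step It) !(itin_step It') /branch eq_b bj eqxx.
  set e1 := _ - _; set e2 := _ - _; have -> : e2 - e1 = (2 * m%:R + 1) * (q j - q i).
    by rewrite /e1 /e2; ring.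
  have lt12 : e1 < e2 by rewrite /e1 /e2; lra.
  by move=> /(_ lt12 sep); rewrite -[in X in _ -> X](ltr_pM2l D0'); lra.
have := IHN i.+1 j.+1; rewrite !(itin_step It) !(itin_step It') /branch eq_b (negbTE bj).
set e1 := _ - _; set e2 := _ - _; have -> : e2 - e1 = (2 * m%:R + 1) * (q j - q i).
  by rewrite /e1 /e2; ring.
have lt12 : e1 < e2 by rewrite /e1 /e2; lra.
by move=> /(_ lt12 sep); rewrite -[in X in _ -> X](ltr_pM2l D0'); lra.
Qed.

Fixpoint pull_back (m : nat) (b : nat -> nat) (i j : nat) (x : R) : R :=
  if j is j'.+1 then branch_inv m (b i) (pull_back m b i.+1 j' x) else x.

Lemma pull_back_itv m b i j x : (0 < m)%N -> (forall i, (b i <= 2)%N) -> 0 <= x <= 1 ->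
  0 <= pull_back m b i j x <= 1.
Proof.
by move=> m0 b2 x01; elim: j i => [//|j IH] i; exact: branch_inv_itv.
Qed.

Lemma pull_back_affine m b i j : (0 < m)%N -> exists c a,
  [/\ forall x, pull_back m b i j x = c + a * x, `|a| <= 1 & (0 < j)%N -> `|a| < 1].
Proof.
move=> m0; have D0 := slope_gt0 m.
have D1 : 1 < 2 * m%:R + 1 :> R by have : 1 <= m%:R :> R; [rewrite ler1n|lra].
elim: j i => [|j IH] i /=.
  by exists 0, 1; split=> [x||//]; rewrite ?normr1 // add0r mul1r.
have [c [a [E a1 _]]] := IH i.+1; rewrite /branch_inv.
have aD (a' : R) : `|a'| = `|a| -> `|a' / (2 * m%:R + 1)| < 1.
  by move=> E'; rewrite normrM E' normfV (gtr0_norm D0) ltr_pdivrMr // mul1r (le_lt_trans a1).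
have Dn0 : 2 * m%:R + 1 != 0 :> R by rewrite gt_eqF.
case: eqP => _.
  exists ((2 * m%:R - c) / (2 * m%:R + 1)), (- a / (2 * m%:R + 1)); split=> [x||_].
  - by rewrite E; field.
  - by rewrite ltW // aD // normrN.
  - by rewrite aD // normrN.
exists ((c + (2 * m%:R - 2 + (b i)%:R)) / (2 * m%:R + 1)), (a / (2 * m%:R + 1)).
split=> [x||_]; rewrite ?aD //; last by rewrite ltW // aD.
by rewrite E; field.
Qed.

Lemma periodic_modn (T : Type) (f : nat -> T) p : (forall i, f (i + p)%N = f i) ->
  forall i, f (i %% p)%N = f i.
Proof.
move=> per i; rewrite [in RHS](divn_eq i p); elim: (i %/ p)%N => [|k IH] //.
by rewrite mulSn -addnA addnC per.
Qed.

(** Over one period the inverse branches compose to an affine contraction of [0, 1], whose fixed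
    point starts the new orbit. [itin_lt] in both directions shows that the orbits are ordered
    alike, so injectivity and the minimality of time 0 carry over. *)
Lemma model_transfer m m' p b q : (0 < m)%N -> (0 < m')%N -> model m p b q ->
  exists q', model m' p b q' /\ forall i j, (q' i <= q' j) = (q i <= q j).
Proof.
move=> m0 m0' [It p1 perq perb injq minq b0 bp].
have p0 : (0 < p)%N by exact: ltnW.
have b2 := itin_branch It.
have bmod := periodic_modn perb.
have [c [a [aff _ /(_ p0) a1]]] := pull_back_affine b 0 p m0'.
(* The fixed point is [c / (1 - a)]; it lies in [0, 1] because [c] and [c + a], the values at 0 and
   1, do. *)
have [x x01 xE] : exists2 x, 0 <= x <= 1 & pull_back m' b 0 p x = x.
  have I0 : 0 <= (0 : R) <= 1 by rewrite lexx ler01.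
  have I1 : 0 <= (1 : R) <= 1 by rewrite ler01 lexx.
  have := pull_back_itv 0 p m0' b2 I0; have := pull_back_itv 0 p m0' b2 I1.
  rewrite !aff mulr0 mulr1 addr0 => /andP[_ ca1] /andP[c0 _].
  have a1' : 0 < 1 - a by rewrite subr_gt0 (le_lt_trans (ler_norm a)).
  exists (c / (1 - a)); last by rewrite aff; field; rewrite gt_eqF.
  by rewrite divr_ge0 ?(ltW a1') //= ler_pdivrMr // mul1r; lra.
(* [x] is pulled back along the branches that remain in the period. The length is never 0: at
   residue 0 the whole period is pulled back, which returns [x]. *)
pose q' i := pull_back m' b (i %% p)%N (p - i %% p)%N x.
have q'01 i : 0 <= q' i <= 1 by exact: pull_back_itv.
have q'mod i : q' (i + p)%N = q' i by rewrite /q' modnDr.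
have q'step i : q' i = branch_inv m' (b i) (q' i.+1).
  rewrite /q' -bmod; have := ltn_pmod i p0; rewrite -(modn_small (ltn_pmod i p0)).
  rewrite -[in (i.+1 %% p)%N]addn1 -[in ((i + 1) %% p)%N]modnDml addn1 modn_mod.
  move: (i %% p)%N => r lt_rp; rewrite -(prednK (n := (p - r)%N)) ?subn_gt0 //=.
  congr branch_inv; case: (ltngtP r.+1 p) => [lt|gt|E].
  - by rewrite modn_small // subnS.
  - lia.
  - by rewrite E modnn subn0 xE -E subSnn.
have q'branch i : q' i.+1 = branch m' (b i) (q' i) by rewrite (q'step i) branchK.
have D0 := slope_gt0 m'.
have m1' : 1 <= m'%:R :> R by rewrite ler1n.
have q'n0 i : q' i != 0.
  apply/eqP => q0.
  have all0 k : q' (i + k)%N = 0 /\ b (i + k)%N = 0%N.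
    elim: k => [|k [IH1 IH2]].
      by rewrite addn0; have := q'01 i.+1; rewrite q'branch q0 => /(branch_0 m0' (b2 i))[? _].
    have := q'01 (i + k).+1; rewrite q'branch IH1 => /(branch_0 m0' (b2 _))[_ E].
    rewrite addnS; have := q'01 (i + k).+2; rewrite q'branch.
    by rewrite q'branch IH1 E => /(branch_0 m0' (b2 _))[? _].
  (* The shift brings [i] to [p.-1] modulo [p], where the branch is not 0. *)
  have [_ E] := all0 (p.-1 + (p - i %% p))%N; move/eqP: bp; apply.
  rewrite -E -bmod -[in RHS]bmod -modnDml addnCA subnKC; last by rewrite ltnW // ltn_pmod.
  by rewrite modnDr.
have q'n1 i : q' i != 1.
  apply/eqP => q1.
  have all1 k : q' (i + k)%N = 1 /\ b (i + k)%N = 2%N.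
    elim: k => [|k [IH1 IH2]].
      by rewrite addn0; have := q'01 i.+1; rewrite q'branch q1 => /(branch_1 m0' (b2 i))[? _].
    have := q'01 (i + k).+1; rewrite q'branch IH1 => /(branch_1 m0' (b2 _))[_ E].
    rewrite addnS; have := q'01 (i + k).+2; rewrite q'branch.
    by rewrite q'branch IH1 E => /(branch_1 m0' (b2 _))[? _].
  have [_] := all1 (p - i %% p)%N; rewrite -bmod -modnDml subnKC ?modnn ?b0 //.
  by rewrite ltnW // ltn_pmod.
have It' : itinerary m' b q'.
  split=> // i; have /andP[? ?] := q'01 i.
  by rewrite lt_def q'n0 lt_def eq_sym q'n1; apply/and3P.
have ltE i j : (q' i < q' j) = (q i < q j).
  by apply/idP/idP; [exact: (itin_lt m0' It' It)|exact: (itin_lt m0 It It')].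
have leE i j : (q' i <= q' j) = (q i <= q j) by rewrite !leNgt ltE.
exists q'; split=> //; split=> // [i j lti ltj|i]; last by rewrite leE.
by move/eqP; rewrite eq_le !leE -eq_le => /eqP; exact: injq.
Qed.

Definition times (p : nat) (q : nat -> R) : seq nat := sort (fun i j => q i <= q j) (iota 0 p).

Lemma model_core m p b q : model m p b q -> core b (times p q).
Proof.
case=> _ p1 _ _ injq minq b0 bp.
have sz : size (times p q) = p by rewrite size_sort size_iota.
split; rewrite ?sz ?perm_sort //.
have tr : transitive (fun i j => q i <= q j) by move=> x y z; exact: le_trans.
have : sorted (fun i j => q i <= q j) (times p q).
  by apply: sort_sorted => x y; exact: le_total.
have mem0 : 0%N \in times p q by rewrite mem_sort mem_iota /= add0n ltnW.
have : {subset times p q <= iota 0 p} by move=> i; rewrite mem_sort.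
case: (times p q) mem0 => // i s mem0 sub; rewrite /= path_sortedE // => /andP[/allP le_i _].
have lt_i : (i < p)%N by have := sub i (mem_head _ _); rewrite mem_iota.
apply: injq => //; first exact: ltnW.
apply: le_anti; rewrite minq andbT.
by move: mem0; rewrite inE => /predU1P[<-//|]; exact: le_i.
Qed.

End Itineraries.

(** * Branches and local behaviour of the truncated map *)

Section LocalBehaviour.
Local Open Scope ring_scope.
Variables (R : realType) (g : spoint R -> spoint R) (t : R).
Hypothesis t01 : 0 < t < 1.

(** Two local behaviours come with their own radii; a pair of points within both confronts them. *)
Lemma near0_pair e e' : 0 < e -> 0 < e' -> exists t1 t2,
  [/\ t1 < t2, near0 t t1 e, near0 t t2 e, near0 t t1 e' & near0 t t2 e'].
Proof.
move=> e0 e0'; pose h := Num.min (Num.min e e') (1 - t) / 2.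
have /andP[t0 t1] := t01.
have min0 : 0 < Num.min (Num.min e e') (1 - t) by rewrite !lt_min e0 e0' subr_gt0.
have [he he' ht] : [/\ h < e, h < e' & h < 1 - t].
  have : h < Num.min (Num.min e e') (1 - t) by rewrite /h; lra.
  by rewrite !lt_min => /andP[/andP[? ?] ?].
have h0 : 0 < h by rewrite /h; lra.
exists t, (t + h); rewrite /near0 subrr normr0 addrAC subrr add0r gtr0_norm //.
by split; [lra|split; [lra|split; lra]..].
Qed.

Lemma loc_pres_rev : loc_pres g t -> loc_rev g t -> False.
Proof.
move=> [e [e0 [r H]]] [e' [e0' [r' H']]].
have [t1 [t2 [lt12 n1 n2 n1' n2']]] := near0_pair e0 e0'.
have [u1 [u2 [E1 [E2 lt]]]] := H _ _ n1 n2 lt12.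
have [v1 [v2 [F1 [F2 lt']]]] := H' _ _ n1' n2' lt12.
move: F1 F2; rewrite E1 E2 => -[_ U1] [_ U2]; lra.
Qed.

Lemma loc_pres_noninj : loc_pres g t -> loc_noninj g t -> False.
Proof.
move=> [e [e0 [r H]]] /(_ e e0)[t1 [t2 [n1 [n2 [ne E]]]]].
case: (ltgtP t1 t2) => [lt|lt|//].
  by have [u1 [u2 []]] := H _ _ n1 n2 lt; rewrite E => -> [[->]]; rewrite ltxx.
by have [u1 [u2 []]] := H _ _ n2 n1 lt; rewrite E => -> [[->]]; rewrite ltxx.
Qed.

Lemma loc_rev_noninj : loc_rev g t -> loc_noninj g t -> False.
Proof.
move=> [e [e0 [r H]]] /(_ e e0)[t1 [t2 [n1 [n2 [ne E]]]]].
case: (ltgtP t1 t2) => [lt|lt|//].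
  by have [u1 [u2 []]] := H _ _ n1 n2 lt; rewrite E => -> [[->]]; rewrite ltxx.
by have [u1 [u2 []]] := H _ _ n2 n1 lt; rewrite E => -> [[->]]; rewrite ltxx.
Qed.

End LocalBehaviour.

Section BranchMap.
Local Open Scope ring_scope.
Variables (R : realType) (n m : nat).
Hypothesis m_gt0 : (0 < m)%N.

Lemma fmap_branch k (t : R) : (k <= 2)%N -> 0 < branch m k t < 1 ->
  fmap n m (SE 0 t) = SE (if k == 0%N then (m - 1)%N else m) (branch m k t).
Proof.
move=> k2 B; have /andP[B1 B2] := branch_itv B.
have DE : (2 * m + 1)%N%:R = 2 * m%:R + 1 :> R by rewrite natrD natrM.
have m1 : 1 <= m%:R :> R by rewrite ler1n.
have k0 := ler0n R k.
(* Branches 0, 1, 2 live on the subintervals of index [2m - 2], [2m - 1], [2m]. *)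
have jE : Num.truncn ((2 * m + 1)%N%:R * t) = (2 * m + k - 2)%N.
  have le2 : (2 <= 2 * m + k)%N by lia.
  have E : (2 * m + k - 2)%N%:R = 2 * m%:R + k%:R - 2 :> R.
    by rewrite (natrB _ le2) (natrD _ (2 * m)) natrM.
  have E1 : (2 * m + k - 2).+1%:R = (2 * m + k - 2)%N%:R + 1 :> R by rewrite natr1.
  by apply: truncn_def; rewrite E1 E DE; lra.
rewrite /fmap eqxx jE DE (natrB _ (_ : 2 <= 2 * m + k)%N) ?(natrD _ (2 * m)) ?natrM; last lia.
case: k k2 jE B B1 B2 k0 => [|[|[|//]]] _ _; rewrite /branch /= => B B1 B2 _.
- rewrite addn0 -[X in (_ - X)%N]muln1 -mulnBr mul2n odd_double doubleK.
  rewrite double_eq0; set u := _ - _; set v := _ - _.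
  have -> : u = v by rewrite /u /v; ring.
  (* For [m = 1] the subinterval has index 0, which [fmap] treats apart; both cases land on edge
     [m - 1]. *)
  by case: eqP => [->|].
- have -> : (2 * m + 1 - 2 = (m - 1).*2.+1)%N by rewrite -mul2n; lia.
  rewrite /= odd_double /= /mkpt doubleK (_ : (m - 1).+1 = m); last lia.
  set u := 1 - _; set v := _ - _; have -> : u = v by rewrite /u /v; ring.
  by case/andP: B => _ v1; rewrite lt_eqF.
- rewrite addnK mul2n odd_double doubleK double_eq0 gtn_eqF //.
  by congr SE; ring.
Qed.

Lemma fmap_other r (t : R) : r != 0%N -> fmap n m (SE r t) = SE (shift n m r) t.
Proof. by rewrite /fmap => /negbTE ->. Qed.

Lemma branch_itv01 k (t : R) : (k <= 2)%N -> 0 < branch m k t < 1 -> 0 < t < 1.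
Proof.
move=> k2 B; have /andP[B1 B2] := branch_itv B; have D0 := slope_gt0 R m.
have m1 : 1 <= m%:R :> R by rewrite ler1n.
have k0 := ler0n R k; have {}k2 : k%:R <= 2 :> R by rewrite ler_nat.
apply/andP; split.
  by rewrite -(pmulr_rgt0 _ D0); lra.
by rewrite -(ltr_pM2l D0); lra.
Qed.

Lemma trunc_branch (tc : nat -> nat -> R) k t : (k <= 2)%N -> 0 < branch m k t < 1 ->
  tc (m - 1)%N 0%N = tc m 0%N ->
  trunc n m tc (SE 0 t) =
  SE (if k == 0%N then (m - 1)%N else m) (Num.max (branch m k t) (tc m 0%N)).
Proof. by move=> k2 B E; rewrite /trunc (fmap_branch k2 B); case: ifP => _; rewrite ?E. Qed.

Lemma branch_diff k (t u : R) : branch m k u =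
  branch m k t + (if k == 1%N then -1 else 1) * (2 * m%:R + 1) * (u - t).
Proof. by rewrite /branch; case: ifP => _; ring. Qed.

Lemma branch_near k (t lo hi : R) : lo < branch m k t < hi -> exists2 e, 0 < e &
  forall u, `|u - t| < e -> lo < branch m k u < hi.
Proof.
move=> /andP[l h]; have D0 := slope_gt0 R m.
exists (Num.min (branch m k t - lo) (hi - branch m k t) / (2 * m%:R + 1)).
  by rewrite divr_gt0 // lt_min !subr_gt0 l.
move=> u; rewrite ltr_pdivlMr // mulrC => lt_u; rewrite (branch_diff k t u).
set c := (if _ then _ else _) * _ * _.
have : `|c| < Num.min (branch m k t - lo) (hi - branch m k t).
  apply: le_lt_trans lt_u; rewrite /c !normrM (gtr0_norm D0).
  by case: ifP => _; rewrite ?normrN normr1 mul1r.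
by rewrite lt_min !ltr_norml => /andP[/andP[? ?] /andP[? ?]]; apply/andP; split; lra.
Qed.

Variables (tc : nat -> nat -> R) (k : nat) (t : R).
Hypotheses (k2 : (k <= 2)%N) (tcE : tc (m - 1)%N 0%N = tc m 0%N).

Lemma trunc_loc_pres : k != 1%N -> 0 <= tc m 0%N -> tc m 0%N < branch m k t < 1 ->
  loc_pres (trunc n m tc) t.
Proof.
move=> k1 tc0 /branch_near[e e0 H]; exists e; split=> //.
exists (if k == 0%N then (m - 1)%N else m) => t1 t2 [_ [_ /H H1]] [_ [_ /H H2]] lt12.
have D0 := slope_gt0 R m; have /andP[? ?] := H1; have /andP[? ?] := H2.
exists (branch m k t1), (branch m k t2); rewrite !(@trunc_branch _ k) //; try lra.
rewrite !max_l ?ltW //; split=> //; split=> //.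
by rewrite (branch_diff k t1 t2) (negbTE k1) mul1r ltrDl mulr_gt0 // subr_gt0.
Qed.

Lemma trunc_loc_rev : k = 1%N -> 0 <= tc m 0%N -> tc m 0%N < branch m k t < 1 ->
  loc_rev (trunc n m tc) t.
Proof.
move=> k1 tc0 /branch_near[e e0 H]; exists e; split=> //.
exists (if k == 0%N then (m - 1)%N else m) => t1 t2 [_ [_ /H H1]] [_ [_ /H H2]] lt12.
have D0 := slope_gt0 R m; have /andP[? ?] := H1; have /andP[? ?] := H2.
exists (branch m k t1), (branch m k t2); rewrite !(@trunc_branch _ k) //; try lra.
rewrite !max_l ?ltW //; split=> //; split=> //.
by rewrite (branch_diff k t1 t2) k1 eqxx mulN1r mulNr gtrDl oppr_lt0 mulr_gt0 // subr_gt0.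
Qed.

(** On the side of [t] where the branch falls below the leftmost point, the retraction makes the
    truncated map constant. *)
Lemma trunc_loc_noninj : branch m k t = tc m 0%N -> 0 < tc m 0%N < 1 ->
  loc_noninj (trunc n m tc) t.
Proof.
move=> bE tc01 e e0; have := tc01; rewrite -bE => /branch_near[e1 e10 H1].
have D0 := slope_gt0 R m.
pose h := Num.min e e1 / 3.
have min0 : 0 < Num.min e e1 by rewrite lt_min e0.
have [he he1] : 2 * h < e /\ 2 * h < e1.
  have : 2 * h < Num.min e e1 by rewrite /h; lra.
  by rewrite lt_min => /andP[].
have h0 : 0 < h by rewrite /h; lra.
(* The direction in which the branch decreases. *)
pose s : R := if k == 1%N then 1 else -1.
have s1 : s = 1 \/ s = -1 by rewrite /s; case: ifP; [left|right].
have low c : 0 < c -> c <= 2 * h -> [/\ near0 t (t + s * c) e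
    & trunc n m tc (SE 0 (t + s * c)) = SE (if k == 0%N then (m - 1)%N else m) (tc m 0%N)].
  move=> c0 c2; have nE : `|t + s * c - t| = c.
    by rewrite addrAC subrr add0r; case: s1 => ->; rewrite ?mulN1r ?normrN ?mul1r gtr0_norm.
  have B : 0 < branch m k (t + s * c) < 1 by apply: H1; rewrite nE; lra.
  have /andP[? ?] := branch_itv01 k2 B.
  split; first by rewrite /near0 nE; split; [lra|split; lra].
  rewrite (trunc_branch k2 B) // max_r // (branch_diff k t) bE addrAC subrr add0r.
  rewrite gerDl /s; case: ifP => _; have := mulr_gt0 D0 c0; lra.
have [n1 T1] := low h h0 ltac:(lra); have [n2 T2] := low (2 * h) ltac:(lra) (lexx _).
exists (t + s * h), (t + s * (2 * h)); split=> //; split=> //; split; last by rewrite T1 T2.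
by move/addrI; case: s1 => ->; lra.
Qed.

End BranchMap.

(** * The star-orbit of a model *)

Arguments fmap : simpl never.

Section ModelOrbit.
Local Open Scope ring_scope.
Variables (R : realType) (n m p : nat) (b : nat -> nat) (q : nat -> R).
Hypotheses (m_gt0 : (0 < m)%N) (lt_mn : (m < n)%N) (co_mn : coprime m n).
Hypothesis M : model m p b q.
Local Notation L := (times p q).
Let C : core b L := model_core M.

Definition point (x : nat * nat) : spoint R := SE x.1 (q x.2).
Local Notation x0 := (SE 0%N (q 0%N)).
Local Notation orb_state := (state n m b L).
Local Notation step := (step n m b L).
Local Notation orb_edge := (edge n m b L).
Local Notation d := (mkdata n m b L).

Lemma size_times : size L = p. Proof. by rewrite size_sort size_iota. Qed.

Lemma q_modn i : q (i %% p)%N = q i.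
Proof. exact: periodic_modn (model_q M) i. Qed.

Lemma edge_lt r i : i \in orb_edge r -> (i < p)%N.
Proof. by rewrite mem_edge // size_times => /andP[]. Qed.

Lemma q_itv i : 0 < q i < 1. Proof. exact: itin_itv (model_itin M) i. Qed.

Lemma branch_q i : 0 < branch m (b i) (q i) < 1.
Proof. by rewrite -(itin_step (model_itin M)) q_itv. Qed.

Lemma fmap_point x : orb_state x -> fmap n m (point x) = point (step x).
Proof.
case: x => r i /andP[/= lt_r /edge_lt lt_i]; rewrite /point /step /=.
case: eqP => [->|/eqP r0] /=; last by rewrite fmap_other.
rewrite (fmap_branch n m_gt0 _ (branch_q i)) ?(itin_branch (model_itin M)) //.
by rewrite size_times q_modn (itin_step (model_itin M)).
Qed.

Lemma iter_fmap_point k x : orb_state x ->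
  iter k (fmap n m) (point x) = point (iter k step x) /\ orb_state (iter k step x).
Proof.
move=> sx; elim: k => [//|k [IH IHs]]; rewrite !iterS IH fmap_point //; split=> //.
exact: step_state.
Qed.

Lemma in_orbP y : in_orb n m x0 y <-> exists2 x, orb_state x & y = point x.
Proof.
have s0 : orb_state (0, 0)%N by exact: state_00.
split=> [[k ->]|[x sx ->]].
  have [-> ?] := iter_fmap_point k s0; by exists (iter k step (0, 0)%N).
have [|[k E] _] := @fcycle_traject _ _ _ (0, 0)%N (full_cycle_cycle m_gt0 lt_mn co_mn C).
  by rewrite mem_full_cycle.
have : x \in traject step (0, 0)%N (size (full_cycle n m b L)) by rewrite E mem_rot mem_full_cycle.
by case/trajectP => i _ ->; exists i; rewrite -(proj1 (iter_fmap_point i s0)).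
Qed.

Lemma in_orb_edge r t : in_orb n m x0 (SE r t) <-> (r < n)%N /\ exists2 i, i \in orb_edge r & t = q i.
Proof.
rewrite in_orbP; split=> [[[r' i] /andP[/= lt_r iE] [-> ->]]|[lt_r [i iE ->]]].
  by split=> //; exists i.
by exists (r, i); rewrite // /state /= lt_r.
Qed.

Lemma q_inj_edge r : {in orb_edge r &, injective q}.
Proof. by move=> i j /edge_lt lti /edge_lt ltj; apply: (model_inj M). Qed.

Lemma sorted_edge r : sorted <%R (map q (orb_edge r)).
Proof.
rewrite lt_sorted_uniq_le map_inj_in_uniq ?edge_uniq //=; last exact: q_inj_edge.
rewrite sorted_map.
have tr : transitive (fun i j => q i <= q j) by move=> x y z; exact: le_trans.
have sL : sorted (fun i j => q i <= q j) L by apply: sort_sorted => x y; exact: le_total.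
by rewrite /edge; case: ifP => _ //; apply: sorted_filter.
Qed.

Definition position r s := q (nth 0%N (orb_edge r) s).

Lemma labelling_position : labelling n m x0 (dN d) position.
Proof.
split; first by rewrite size_map size_iota.
move=> r lt_r; rewrite nth_dN //; split.
  move=> s1 s2 lt12 lt2; rewrite /position.
  have lt1 := ltn_trans lt12 lt2.
  have := lt_sorted_ltn_nth (0 : R) (sorted_edge r); rewrite size_map => /(_ s1 s2).
  by rewrite !inE !(nth_map 0%N) // => -> //.
move=> t; rewrite in_orb_edge; split=> [[_ [i iE ->]]|[s lt_s ->]].
  by exists (index i (orb_edge r)); rewrite ?index_mem // /position nth_index.
by split=> //; exists (nth 0%N (orb_edge r) s); rewrite // mem_nth.
Qed.

(** A strictly increasing enumeration is determined by its set of values; this is what makes the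
    data of an orbit unique. *)
Lemma labelling_unique N tc : labelling n m x0 N tc ->
  N = dN d /\ forall r s, (r < n)%N -> (s < size (orb_edge r))%N -> tc r s = position r s.
Proof.
move=> [szN H].
have E r : (r < n)%N -> map (tc r) (iota 0 (nth 0%N N r)) = map q (orb_edge r).
  move=> lt_r; have [Hlt Hin] := H r lt_r.
  apply: lt_sorted_eq; last first.
  - move=> t; apply/mapP/mapP => [[s]|[i iE ->]].
      rewrite mem_iota /= => lt_s ->; have /in_orb_edge[_ [i iE ->]] :
        in_orb n m x0 (SE r (tc r s)) by apply/Hin; exists s.
      by exists i.
    have /Hin[s lt_s sE] : in_orb n m x0 (SE r (q i)) by apply/in_orb_edge; split=> //; exists i.
    by exists s; rewrite ?mem_iota.
  - exact: sorted_edge.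
  rewrite sorted_map; apply: (@sub_in_sorted _ (mem (iota 0 (nth 0%N N r))) ltn).
  - move=> i j _ j_in lt_ij; apply: Hlt => //.
    by have : j \in iota 0 (nth 0%N N r) := j_in; rewrite mem_iota.
  - exact: allss.
  - exact: iota_ltn_sorted.
have sE r : (r < n)%N -> nth 0%N N r = size (orb_edge r).
  by move=> lt_r; have /(congr1 size) := E r lt_r; rewrite !size_map size_iota.
split.
  apply: (@eq_from_nth _ 0%N); first by rewrite size_map size_iota.
  by move=> r; rewrite szN => lt_r; rewrite nth_dN // sE.
move=> r s lt_r lt_s; have /(congr1 (nth 0 ^~ s)) := E r lt_r.
by rewrite !(nth_map 0%N) ?size_iota ?sE // nth_iota ?sE.
Qed.

Lemma times_0 : nth 0%N L 0 = 0%N. Proof. exact: core_min C. Qed.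

Lemma position_0 r : (r < n)%N -> position r 0 = q 0%N.
Proof.
move=> lt_r; rewrite /position; congr q.
have := mem_edge_0 n m C r; have := lab_r0 n m C r.
by rewrite /lab /= => -[E] /(nth_index 0%N); rewrite E.
Qed.

Lemma position_inj r s i : (s < size (orb_edge r))%N -> i \in orb_edge r ->
  position r s = q i -> s = index i (orb_edge r).
Proof.
move=> lt_s iE /q_inj_edge E; rewrite -(E r _ iE) ?mem_nth // index_uniq //.
exact: edge_uniq.
Qed.

Lemma q_gt_min i : (0 < i < p)%N -> q 0%N < q i.
Proof.
move=> /andP[i0 ip]; rewrite lt_def (model_min M) andbT; apply/eqP => E.
by move: i0; rewrite (model_inj M _ _ E) // (leq_ltn_trans _ ip).
Qed.

(** The image of time [i] is strictly above the leftmost point unless [i = p.-1]; there the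
    retraction acts trivially nearby and the sign of the slope decides. *)
Lemma local_type tc s : tc (m - 1)%N 0%N = q 0%N -> tc m 0%N = q 0%N -> (s < p)%N ->
  let i := nth 0%N L s in
  [/\ i = p.-1 -> loc_noninj (trunc n m tc) (q i),
      i != p.-1 -> b i = 1%N -> loc_rev (trunc n m tc) (q i)
    & i != p.-1 -> b i != 1%N -> loc_pres (trunc n m tc) (q i)].
Proof.
move=> t1 t2 lt_s i.
have p0 : (0 < p)%N by exact: leq_ltn_trans lt_s.
have lt_i : (i < p)%N by rewrite -[X in (_ < X)%N]size_times -(mem_L C) mem_nth ?size_times.
have b2 := itin_branch (model_itin M) i.
have /andP[q00 q01] := q_itv 0.
have E12 : tc (m - 1)%N 0%N = tc m 0%N by rewrite t1 t2.
have B : i != p.-1 -> tc m 0%N < branch m (b i) (q i) < 1.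
  move=> ip; have /andP[_ ->] := branch_q i; rewrite andbT t2 -(itin_step (model_itin M)).
  by apply: q_gt_min; move/eqP: ip; lia.
split=> [ip|ip bi|ip bi].
- apply: (trunc_loc_noninj n m_gt0 b2 E12); last by rewrite t2 q00.
  rewrite t2 -(itin_step (model_itin M)) ip prednK //.
  by rewrite -[p]add0n (model_q M).
- by apply: (trunc_loc_rev n m_gt0 b2 E12 bi); rewrite ?t2 ?(ltW q00) // -t2 B.
- by apply: (trunc_loc_pres n m_gt0 b2 E12 bi); rewrite ?t2 ?(ltW q00) // -t2 B.
Qed.

Lemma local_labels tc : tc (m - 1)%N 0%N = q 0%N -> tc m 0%N = q 0%N ->
  (forall s, (s < p)%N -> tc 0%N s = q (nth 0%N L s)) ->
  forall s,
  [/\ dA d s <-> (s < p)%N /\ loc_rev (trunc n m tc) (tc 0%N s),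
      dB d s <-> (s < p)%N /\ loc_pres (trunc n m tc) (tc 0%N s)
    & dC d s <-> (s < p)%N /\ loc_noninj (trunc n m tc) (tc 0%N s)].
Proof.
move=> t1 t2 t0 s; rewrite /= size_times.
have [lt_s|ge_s] := ltnP s p; last by split; split=> // -[].
rewrite t0 //; have [Hn Hr Hp] := local_type t1 t2 lt_s.
have q01 := q_itv (nth 0%N L s).
have X1 := @loc_pres_rev _ (trunc n m tc) _ q01.
have X2 := @loc_pres_noninj _ (trunc n m tc) (q (nth 0%N L s)).
have X3 := @loc_rev_noninj _ (trunc n m tc) (q (nth 0%N L s)).
have [ip|ip] := eqVneq (nth 0%N L s) p.-1; rewrite ?andbF ?andbT /=.
  have N := Hn ip; split; split=> // -[_ H]; [case: (X3 H N)|case: (X2 H N)].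
have [bi|bi] := eqVneq (b (nth 0%N L s)) 1%N.
  have N := Hr ip bi; split; split=> // -[_ H]; [case: (X1 H N)|case: (X3 N H)].
have N := Hp ip bi; split; split=> // -[_ H]; [case: (X1 N H)|case: (X2 N H)].
Qed.

Lemma edge_size0 r : (r < n)%N -> (0 < size (orb_edge r))%N.
Proof. by move=> _; case: (orb_edge r) (mem_edge_0 n m C r). Qed.

Lemma data_of_model d' : data_of n m x0 d' <-> d' = d.
Proof.
have n0 : (0 < n)%N by exact: leq_ltn_trans lt_mn.
have lt_m1 : (m - 1 < n)%N by lia.
have N0 : nth 0%N (dN d) 0 = p by rewrite nth_dN // edge0 // size_times.
split; last first.
  move=> ->; exists position; split; first exact: labelling_position.
  have loc := local_labels (position_0 lt_m1) (position_0 lt_mn).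
  have pos0 s : (s < p)%N -> position 0 s = q (nth 0%N L s) by rewrite /position edge0.
  have {}loc := loc pos0.
  rewrite N0; split; last split; last split; last split; try by move=> s; case: (loc s).
    move=> y yl; split; first exact: dpi_label.
    have sy := unlab_state yl; have := fmap_point sy.
    have := dpi_lab sy; rewrite (unlabK C yl) => ->.
    rewrite /point /position /= => ->; rewrite nth_index //.
    by have := step_state m_gt0 lt_mn co_mn C sy => /andP[].
  by move=> y yl; rewrite /= -/(dN d) (negbTE yl).
move=> [tc [lab_tc [dpiP [dpi0P [AP [BP CP]]]]]].
have [NE tcE] := labelling_unique lab_tc.
case: d' NE lab_tc dpiP dpi0P AP BP CP => N' pi' A' B' C' /= -> lab_tc dpiP dpi0P AP BP CP.
rewrite N0 in AP BP CP.
have tm1 : tc (m - 1)%N 0%N = q 0%N by rewrite tcE ?edge_size0 ?position_0.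
have tm : tc m 0%N = q 0%N by rewrite tcE ?edge_size0 ?position_0.
have t0 s : (s < p)%N -> tc 0%N s = q (nth 0%N L s).
  by move=> lt_s; rewrite tcE // ?edge0 // ?size_times // /position edge0.
have {}loc := local_labels tm1 tm t0.
rewrite [RHS](_ : _ = Data (dN d) (dpi d) (dA d) (dB d) (dC d)) //.
congr Data.
- apply: funext => y; case: (boolP (is_label (dN d) y)) => yl; last first.
    by rewrite dpi0P // /= -/(dN d) (negbTE yl).
  have [pl] := dpiP y yl; have sy := unlab_state yl.
  have ss := step_state m_gt0 lt_mn co_mn C sy.
  have := yl; rewrite labelE => /andP[lt_r lt_s].
  rewrite tcE // -[SE _ _]/(point (unlab n m b L y)) fmap_point //.
  have := dpi_lab sy; rewrite (unlabK C yl) => ->.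
  case: (step _) ss => r i /andP[/= lt_r' iE]; rewrite /point /lab /= => -[rE tE].
  case: (pi' y) pl rE tE => r' s' pl /= rE; subst r'.
  move: pl; rewrite labelE /= => /andP[_ lt_s'] tE.
  by rewrite (position_inj lt_s' iE) // -tcE.
- apply: funext => s; apply/idP/idP; first by move/AP; case: (loc s) => [[_]].
  by move=> H; apply/AP; case: (loc s) => [[+ _] _ _]; exact.
- apply: funext => s; apply/idP/idP; first by move/BP; case: (loc s) => _ [_].
  by move=> H; apply/BP; case: (loc s) => _ [+ _] _; exact.
- apply: funext => s; apply/idP/idP; first by move/CP; case: (loc s) => _ _ [_].
  by move=> H; apply/CP; case: (loc s) => _ _ [+ _]; exact.
Qed.

Lemma star_orbit_model : star_orbit n m x0.
Proof.
have n0 : (0 < n)%N by exact: leq_ltn_trans lt_mn.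
have first0 r y : is_first n m x0 r y -> y = SE r (q 0%N).
  move=> [t [-> [/in_orb_edge[lt_r [i iE tE]] tmin]]]; congr SE.
  apply/le_anti; rewrite tE (model_min M) andbT -tE; apply: tmin.
  by apply/in_orb_edge; split=> //; exists 0%N => //; exact: mem_edge_0.
have is_first0 r : (r < n)%N -> is_first n m x0 r (SE r (q 0%N)).
  move=> lt_r; exists (q 0%N); split=> //; split.
    by apply/in_orb_edge; split=> //; exists 0%N => //; exact: mem_edge_0.
  by move=> u /in_orb_edge[_ [i _ ->]]; exact: (model_min M).
have /andP[q00 q01] := q_itv 0.
split; first by split=> //; split=> //; exact: ltW.
split.
  have in00 : (0, 0)%N \in full_cycle n m b L by rewrite mem_full_cycle ?state_00.
  have [_ E] := fcycle_traject (full_cycle_cycle m_gt0 lt_mn co_mn C) in00.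
  exists (size (full_cycle n m b L)); split; first by case: (full_cycle _ _ _ _) in00.
  have [-> _] := iter_fmap_point (size (full_cycle n m b L)) (state_00 m_gt0 lt_mn co_mn C).
  by rewrite E.
split; first by exists x0; split=> //; exists 0%N.
split; first by move=> r lt_r; exists (q 0%N); have [t [[<-] []]] := is_first0 r lt_r.
split.
  (* Branch 0 sends the leftmost point into [e_{m-1}], so the images of the points of [e_0] do not
     all lie in [e_m]. *)
  exists (q 0%N); split; first by exists 0%N.
  move=> u; rewrite (fmap_branch n m_gt0 _ (branch_q 0)) ?(itin_branch (model_itin M)) //.
  by rewrite (model_b0 M) /= => -[]; lia.
move=> r /andP[r0 lt_r] y /first0 ->; rewrite fmap_other -?lt0n //.
by apply: is_first0; rewrite shift_lt.
Qed.

Lemma Pset_model : Pset R n m (m - 1) LB d.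
Proof.
exists x0; split; first exact: star_orbit_model.
- exact/data_of_model.
- have s0 := state_00 m_gt0 lt_mn co_mn C.
  have := dpi_lab s0; rewrite lab_00 // => ->.
  by rewrite /step /lab /= (model_b0 M).
- rewrite /= times_0 (model_b0 M) size_times; have := model_p M.
  by case: p => [|[|k]].
Qed.

End ModelOrbit.

(** * The model of a star-orbit *)

Section StarOrbitModel.
Local Open Scope ring_scope.
Variables (R : realType) (n m : nat).
Hypotheses (m_gt0 : (0 < m)%N) (lt_mn : (m < n)%N) (co_mn : coprime m n).

Let m1 : 1 <= m%:R :> R. Proof. by rewrite ler1n. Qed.
Let D0 := slope_gt0 R m.
Let DE : (2 * m + 1)%N%:R = 2 * m%:R + 1 :> R. Proof. by rewrite natrD natrM. Qed.

Lemma fmap_e0 (t : R) : 0 <= t -> let s := (2 * m%:R + 1) * t in let j := Num.truncn s in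
  j%:R <= s < j%:R + 1 /\
  fmap n m (SE 0%N t) = (if j == 0%N then SE 0 (s - j%:R)
    else if odd j then mkpt (j.+1)./2 (1 - (s - j%:R)) else SE j./2 (s - j%:R)).
Proof.
move=> t0 s j; split; last by rewrite /fmap eqxx DE.
by rewrite natr1; apply: truncn_itv; rewrite mulr_ge0 // ltW.
Qed.

Lemma fmap_valid (y : spoint R) : valid_pt n y -> valid_pt n (fmap n m y).
Proof.
case: y => [//|r t] /= [lt_r [t0 t1]].
have [r0|r0] := eqVneq r 0%N; last by rewrite fmap_other //= shift_lt.
have [] := fmap_e0 t0; rewrite r0; set s := _ * t; set j := Num.truncn s => /andP[j1 j2] ->.
have jm : (j < 2 * m + 1)%N.
  rewrite -(ltr_nat R) DE (le_lt_trans j1) // /s gtr_pMr //.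
case: eqP => [_|/eqP jn0]; first by split; [lia|split; lra].
case: ifP => oj; last by split; [have := half_leq (ltnW jm); lia|split; lra].
rewrite /mkpt; case: eqP => [//|/eqP u1]; split.
  by have := odd_double_half j.+1; lia.
split; first lra.
by rewrite lt_def eq_sym u1; lra.
Qed.

Variable x : spoint R.
Hypothesis sx : star_orbit n m x.
Let n0 : (0 < n)%N. Proof. exact: leq_ltn_trans lt_mn. Qed.

Lemma orb_step y : in_orb n m x y -> in_orb n m x (fmap n m y).
Proof. by case=> i ->; exists i.+1. Qed.

Lemma iter_period_mul k P : iter P (fmap n m) x = x -> iter (k * P) (fmap n m) x = x.
Proof. by move=> E; elim: k => [//|k IH]; rewrite mulSn iterD IH. Qed.

Lemma orb_valid y : in_orb n m x y -> valid_pt n y.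
Proof. by case: sx => vx _ [i ->]; elim: i => [//|i IH]; exact: fmap_valid. Qed.

(** [v] is fixed, so a periodic orbit through it would contain nothing else. *)
Lemma orb_neqSV : ~ in_orb n m x SV.
Proof.
case: sx => _ [[P [P0 PE]] [[y [[i yE] yN]] _]] [j jE].
have SVk k : iter k (fmap n m) SV = SV :> spoint R by elim: k => //= k ->.
apply: yN; rewrite yE -[x in LHS](iter_period_mul j PE) -iterD.
(* Adding [j] periods to [i] makes the index at least [j], from which time on the orbit would stay
   at [v]. *)
have -> : (i + j * P = i + (j * P - j) + j)%N.
  by rewrite -addnA subnK // leq_pmulr.
by rewrite iterD -jE SVk.
Qed.

Lemma orb_same y z : in_orb n m x y -> in_orb n m x z <-> in_orb n m y z.
Proof.
case: sx => _ [[P [P0 PE]] _] [i yE]; split=> [[j ->]|[j ->]]; last first.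
  by exists (j + i)%N; rewrite iterD -yE.
exists (j + (i * P - i))%N; rewrite yE -iterD -addnA subnK ?leq_pmulr //.
by rewrite iterD iter_period_mul.
Qed.

Variable q0 : R.
Hypothesis q0_in : in_orb n m x (SE 0%N q0).
Hypothesis q0_min : forall u, in_orb n m x (SE 0%N u) -> q0 <= u.

Let q0_itv : 0 <= q0 < 1.
Proof. by have /= [_ [-> ->]] := orb_valid q0_in. Qed.

(** The initial point of [e_0] is fixed, whereas the orbit also meets edge [n - 1]. *)
Lemma q0_gt0 : 0 < q0.
Proof.
have /andP[ge0 _] := q0_itv; rewrite lt_def ge0 andbT; apply/eqP => q00.
have fix0 k : iter k (fmap n m) (SE 0%N 0) = SE 0%N 0 :> spoint R.
  by elim: k => //= k ->; rewrite /fmap eqxx mulr0 truncn0 eqxx subr0.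
have [_ [_ [_ [/(_ (n - 1)%N)[]]]]] := sx; first lia.
move=> t; rewrite (orb_same _ q0_in) q00 => -[k]; rewrite fix0 => -[]; lia.
Qed.

Hypothesis q0_image : exists u, fmap n m (SE 0%N q0) = SE (m - 1)%N u.
Variable tc : nat -> nat -> R.
Hypothesis q0_pres : loc_pres (trunc n m tc) q0.

(** A subinterval covering [e_{m-1}] has index [2m - 2], run forwards, or, for [m > 1], index
    [2m - 3], run backwards. The latter contradicts [q0_pres], since the retraction is nondecreasing
    and cannot restore a strict increase. *)
Lemma truncn_q0 : Num.truncn ((2 * m%:R + 1) * q0) = (2 * m - 2)%N.
Proof.
have /andP[ge0 lt1] := q0_itv; have [u] := q0_image; have [] := fmap_e0 ge0.
set s := _ * q0; set j := Num.truncn s => /andP[j1 j2] fE; rewrite fE.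
case: eqP => [->|/eqP jn0]; first by move=> [E _]; lia.
case: ifP => oj; last by move=> [E _]; have := odd_double_half j; rewrite oj E; lia.
rewrite /mkpt; case: eqP => // u1 [E _].
have jm : (j.+1 = 2 * (m - 1))%N.
  by have := odd_double_half j.+1; rewrite /= oj /= -/(uphalf j) E; lia.
exfalso; have [e [e0 [r H]]] := q0_pres.
(* [q0 + h] stays within radius [e], before the end of [e_0], and in the subinterval of [q0]. *)
pose h := Num.min (Num.min e (1 - q0)) ((j%:R + 1 - s) / (2 * m%:R + 1)) / 2.
have min0 : 0 < Num.min (Num.min e (1 - q0)) ((j%:R + 1 - s) / (2 * m%:R + 1)).
  by rewrite !lt_min e0 subr_gt0 lt1 divr_gt0 // subr_gt0.
have h0 : 0 < h by rewrite /h; lra.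
have [he h1 hj] : [/\ h < e, h < 1 - q0 & (2 * m%:R + 1) * h < j%:R + 1 - s].
  have : h < Num.min (Num.min e (1 - q0)) ((j%:R + 1 - s) / (2 * m%:R + 1)) by rewrite /h; lra.
  by rewrite !lt_min ltr_pdivlMr // [h * _]mulrC => /andP[/andP[-> ->] ->].
have Dh : 0 < (2 * m%:R + 1) * h by rewrite mulr_gt0.
have near1 : near0 q0 q0 e by rewrite /near0 subrr normr0.
have near2 : near0 q0 (q0 + h) e.
  by rewrite /near0 addrAC subrr add0r gtr0_norm //; split; [lra|split; lra].
have [v1 [v2 [T1 [T2 lt12]]]] := H _ _ near1 near2 ltac:(lra).
have ge0' : 0 <= q0 + h by lra.
have [_] := fmap_e0 ge0'.
have -> : Num.truncn ((2 * m%:R + 1) * (q0 + h)) = j.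
  by apply: truncn_def; rewrite -[X in _ < X]natr1 mulrDr -/s; lra.
rewrite (negbTE jn0) oj /mkpt lt_eqF; last by rewrite mulrDr -/s; lra.
move=> f2; move: T1 T2; rewrite /trunc fE f2 (negbTE jn0) oj /mkpt ifN; last exact/eqP.
move=> -[_ V1] [_ V2]; move: lt12; rewrite -V1 -V2; apply/negP; rewrite -leNgt.
rewrite ge_max !le_max lexx orbT andbT mulrDr -/s; apply/orP; left; lra.
Qed.

Definition branch_of (t : R) : nat := (Num.truncn ((2 * m%:R + 1)%R * t) - (2 * m - 2))%N.
Definition return_map (t : R) : R := branch m (branch_of t) t.

(** No orbit point of [e_0] is left of [q0], so all lie in the subinterval [2m - 2] or later, and
    the truncated subtraction in [branch_of] loses nothing. *)
Lemma fmap_orb t : in_orb n m x (SE 0%N t) ->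
  [/\ (branch_of t <= 2)%N,
      fmap n m (SE 0%N t) = SE (if branch_of t == 0%N then (m - 1)%N else m) (return_map t)
    & 0 <= return_map t < 1].
Proof.
move=> tin; have /= [_ [t0 t1]] := orb_valid tin.
have fin := orb_step tin; have fv := orb_valid fin.
have [] := fmap_e0 t0; rewrite /return_map /branch_of.
set s := _ * t; set j := Num.truncn s => /andP[j1 j2] fE.
have jm : (j < 2 * m + 1)%N by rewrite -(ltr_nat R) DE (le_lt_trans j1) // /s gtr_pMr.
have jm' : (2 * m - 2 <= j)%N.
  rewrite -truncn_q0; apply: le_truncn; rewrite /s ler_pM2l //; exact: q0_min.
have [k jE] : exists k, j = (2 * m - 2 + k)%N by exists (j - (2 * m - 2))%N; lia.
have jR : j%:R = 2 * m%:R - 2 + k%:R :> R.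
  by rewrite jE natrD natrB ?natrM //; lia.
have k2 : (k <= 2)%N by lia.
have -> : (j - (2 * m - 2) = k)%N by lia.
suff E : fmap n m (SE 0%N t) = SE (if k == 0%N then (m - 1)%N else m) (branch m k t).
  by split=> //; move: fv; rewrite E /= => -[_ [-> ->]].
move: fin; rewrite fE /branch -/s.
case: k k2 jE jR => [|[|[|//]]] _ jE jR /=.
- case: eqP => [j0|_]; first by move=> _; rewrite jR; congr SE; lia.
  have -> : odd j = false by rewrite jE; lia.
  by move=> _; rewrite jR; congr SE; lia.
- have -> : (j == 0%N) = false by lia.
  have -> : odd j by rewrite jE; lia.
  rewrite /mkpt; case: eqP => [_ /orb_neqSV//|_ _]; congr SE; first lia.
  by rewrite jR; ring.
- have -> : (j == 0%N) = false by lia.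
  have -> : odd j = false by rewrite jE; lia.
  by move=> _; rewrite jR; congr SE; lia.
Qed.

Definition qs i := iter i return_map q0.
Definition bs i := branch_of (qs i).

Lemma orb_shift r t : r != 0%N -> in_orb n m x (SE r t) -> in_orb n m x (SE (shift n m r) t).
Proof. by move=> r0 /orb_step; rewrite fmap_other. Qed.

Lemma orb_pred_O0 t r : in_orb n m x (SE (m - 1)%N t) -> r \in O0 n m -> in_orb n m x (SE r t).
Proof. by move=> tin; move: r; apply: O0_ind => // r _; exact: orb_shift. Qed.

Lemma orb_O1 t r : in_orb n m x (SE m t) -> r \in O1 n m -> in_orb n m x (SE r t).
Proof.
move=> tin; move: r; apply: O1_ind => // r r1 _; apply: orb_shift; exact: O1_neq0 r1.
Qed.

Lemma orb_qs i : in_orb n m x (SE 0%N (qs i)).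
Proof.
elim: i => [//|i IH]; have [_ fE _] := fmap_orb IH.
have := orb_step IH; rewrite fE -/(qs i.+1) => fin.
apply: orb_pred_O0 (mem_0_O0 m_gt0 lt_mn co_mn).
move: fin; case: eqP => // _ fin; rewrite -(shift_pred m_gt0 lt_mn co_mn).
apply: orb_shift; first by have := O1_neq0 m_gt0 lt_mn co_mn (mem_n_O1 m_gt0 lt_mn co_mn).
exact: orb_O1 fin (mem_n_O1 m_gt0 lt_mn co_mn).
Qed.

Lemma qs_itv i : 0 < qs i < 1.
Proof.
have /= [_ [_ ->]] := orb_valid (orb_qs i).
by rewrite (lt_le_trans q0_gt0 (q0_min (orb_qs i))).
Qed.

(** The last clause remembers how time [i] was entered: a visit to [O1] requires a preceding branch
    other than 0. *)
Lemma orb_visit k : exists r i, [/\ iter k (fmap n m) (SE 0%N q0) = SE r (qs i), (r < n)%N,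
  (0 < k)%N -> (0 < i)%N & r \in O1 n m -> (0 < i)%N /\ bs i.-1 != 0%N].
Proof.
elim: k => [|k [r [i [kE lt_r ki r1]]]].
  by exists 0%N, 0%N; split=> //; rewrite mem_O1 // mem_0_O0.
have [r0|r0] := eqVneq r 0%N.
  exists (if bs i == 0%N then (m - 1)%N else m), i.+1; split=> //=.
  - by rewrite kE r0; have [_ -> _] := fmap_orb (orb_qs i).
  - by case: ifP => _; lia.
  - by case: eqP => //; rewrite mem_O1 ?mem_pred_O0 //; lia.
exists (shift n m r), i; split; rewrite ?shift_lt //.
- by rewrite iterS kE fmap_other.
- by move=> _; case: (k) kE ki => [[/esym r0']|k' _]; [rewrite r0' eqxx in r0|exact].
move=> sr1; apply: r1; have [rn|rn] := eqVneq r (n - 1)%N.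
  by move: sr1; rewrite rn shift_pred // mem_O1 ?mem_pred_O0 //; lia.
by move: sr1; rewrite !mem_O1 ?shift_lt // shift_O0.
Qed.

Lemma qs_period : exists p, [/\ (0 < p)%N, qs p = q0
  & forall i, (0 < i)%N -> qs i = q0 -> (p <= i)%N].
Proof.
have [_ [[P [P0 PE]] _]] := sx; have [i0 q0E] := q0_in.
have ex : exists i, (0 < i)%N && (qs i == q0).
  have [r [i [E _ /(_ P0) i_gt0 _]]] := orb_visit P.
  exists i; rewrite i_gt0 /=; apply/eqP; move: E.
  by rewrite q0E -iterD addnC iterD PE -q0E => -[].
case: (ex_minnP ex) => p /andP[p0 /eqP pE] pmin.
by exists p; split=> // i i_gt0 /eqP iE; apply: pmin; rewrite i_gt0.
Qed.

(** The star condition carries leftmost points to leftmost points from [n - 1] to [m - 1] and along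
    [O0] to [0], all at constant [t]. *)
Lemma first_chain t : is_first n m x (n - 1)%N (SE (n - 1)%N t) -> t = q0.
Proof.
have [_ [_ [_ [_ [_ Hfirst]]]]] := sx => F.
have F0 : is_first n m x 0 (SE 0%N t).
  suff H : forall r, r \in O0 n m -> is_first n m x r (SE r t) by exact: H (mem_0_O0 m_gt0 lt_mn co_mn).
  have stp r : (0 < r < n)%N -> is_first n m x r (SE r t) ->
      is_first n m x (shift n m r) (SE (shift n m r) t).
    move=> r_itv /(Hfirst _ r_itv); rewrite fmap_other //; lia.
  apply: O0_ind => //.
    by rewrite -(shift_pred m_gt0 lt_mn co_mn); apply: stp => //; lia.
  move=> r r0 rn0; apply: stp; rewrite lt0n rn0 /=; exact: O0_lt r0.
have [_ [[<-] [tin tmin]]] := F0; apply: le_anti.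
by rewrite q0_min // tmin.
Qed.

Lemma model_of_orbit t : is_first n m x (n - 1)%N (SE (n - 1)%N t) ->
  exists p, model m p bs qs.
Proof.
move=> F; have tE := first_chain F; rewrite {}tE in F.
have [p [p0 pE pmin]] := qs_period; exists p.
have qper i : qs (i + p)%N = qs i by rewrite /qs iterD -/(qs p) pE.
have bper i : bs (i + p)%N = bs i by rewrite /bs qper.
have qinj i j : (i < p)%N -> (j < p)%N -> qs i = qs j -> i = j.
  wlog lt_ij : i j / (i < j)%N.
    move=> wlg lti ltj E; case: (ltngtP i j) => // lt; first exact: wlg E.
    by apply/esym/wlg.
  move=> lti ltj E; have : qs (i + (p - j))%N = q0.
    have -> : qs (i + (p - j))%N = qs (j + (p - j))%N.
      by rewrite /qs addnC iterD -/(qs i) E -iterD addnC.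
    by rewrite subnKC ?pE // ltnW.
  by move=> /pmin; lia.
have qmin i : qs 0 <= qs i by exact: q0_min (orb_qs i).
have b0 : bs 0 = 0%N by rewrite /bs /qs /= /branch_of truncn_q0 subnn.
(* [q0] is met on edge [n - 1], hence at a positive time [i] entered by a nonzero branch; [i] is a
   multiple of [p], so this branch is the one at [p.-1]. *)
have bp : bs p.-1 != 0%N.
  have [_ [_ [+ _]]] := F; rewrite (orb_same _ q0_in) => -[k kE].
  have [r [i [E _ _ r1]]] := orb_visit k.
  move: E; rewrite -kE => -[rE qE].
  have [] := r1; first by rewrite -rE mem_n_O1.
  move=> i0; have : (i %% p = 0)%N.
    by apply: qinj; rewrite ?ltn_pmod // (periodic_modn qper) -qE.
  move=> ip; have -> : bs i.-1 = bs p.-1; last by [].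
  rewrite -[LHS](periodic_modn bper) -[RHS](periodic_modn bper); congr bs.
  have dv : (p %| i)%N by rewrite /dvdn ip.
  have [k' iE] := dvdnP dv; case: k' iE => [|k'] iE; first by rewrite iE in i0.
  by rewrite iE mulSn -(prednK p0) addSn /= (prednK p0) addnC modnMDl.
have bran i : (bs i <= 2)%N by have [] := fmap_orb (orb_qs i).
split=> //; first by split=> // i; exact: qs_itv.
by case: p p0 bp {pE pmin qper bper qinj} => [|[|k]] //=; rewrite b0.
Qed.

End StarOrbitModel.

(** * Orbits of P(m/n, m-1, B) as models, and the transfer between stars *)

Section PsetModel.
Local Open Scope ring_scope.
Variables (R : realType) (n m : nat).
Hypotheses (m_gt0 : (0 < m)%N) (lt_mn : (m < n)%N) (co_mn : coprime m n).

Lemma data_of_same (x y : spoint R) d : (forall z, in_orb n m x z <-> in_orb n m y z) ->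
  data_of n m x d -> data_of n m y d.
Proof.
move=> E [tc [[szN H] rest]]; exists tc; split=> //; split=> // r lt_r.
have [H1 H2] := H r lt_r; split=> // t; rewrite -E; exact: H2.
Qed.

Lemma Pset_modelP d : Pset R n m (m - 1) LB d <->
  exists p b q, @model R m p b q /\ d = mkdata n m b (times p q).
Proof.
split; last by move=> [p [b [q [M ->]]]]; exact: Pset_model M.
case=> x [sx dx k0 B0]; have := dx => -[tc [[szN labP] [dpiP [_ [_ [BP _]]]]]].
have n0 : (0 < n)%N by exact: leq_ltn_trans lt_mn.
have [_ [_ [_ [meet _]]]] := sx.
have Npos r : (r < n)%N -> (0 < nth 0%N (dN d) r)%N.
  move=> lt_r; have [t] := meet r lt_r; have [_ H] := labP r lt_r.
  by move=> /H[s lt_s _]; exact: leq_ltn_trans lt_s.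
have first r : (r < n)%N -> is_first n m x r (SE r (tc r 0%N)).
  move=> lt_r; have [Hlt Hin] := labP r lt_r; exists (tc r 0%N); split=> //; split.
    by apply/Hin; exists 0%N; rewrite ?Npos.
  move=> u /Hin[s lt_s ->]; case: s lt_s => [//|s] lt_s.
  by apply: ltW; apply: Hlt.
have [_ [[<-] [q0_in q0_min]]] := first 0%N n0.
have img : exists u, fmap n m (SE 0%N (tc 0%N 0%N)) = SE (m - 1)%N u.
  have [|_ ->] := dpiP (0, 0)%N; first by rewrite /is_label szN n0 Npos.
  by rewrite k0; exists (tc (m - 1)%N (dpi d (0, 0)%N).2).
have [_ pres] : (0 < nth 0%N (dN d) 0)%N /\ loc_pres (trunc n m tc) (tc 0%N 0%N) by apply/BP.
have lt_n1 : (n - 1 < n)%N by lia.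
have [p M] := model_of_orbit m_gt0 lt_mn co_mn sx q0_in q0_min img pres (first _ lt_n1).
exists p, (bs m (tc 0%N 0%N)), (qs m (tc 0%N 0%N)); split=> //.
apply/(data_of_model m_gt0 lt_mn co_mn M); apply: data_of_same dx => z.
exact: orb_same.
Qed.

End PsetModel.

(** Two general stars are allowed because the transfer runs from 1/2 to m/n and back. Positions
    compare alike in both models, so sorting the times gives the same [L]. *)
Lemma Pset_transfer (R : realType) (n m n' m' : nat) :
  0 < m -> m < n -> coprime m n -> 0 < m' -> m' < n' -> coprime m' n' ->
  forall d, Pset R n m (m - 1) LB d -> exists b L,
    [/\ core b L, d = mkdata n m b L & Pset R n' m' (m' - 1) LB (mkdata n' m' b L)].
Proof.
move=> m0 lt_mn co m0' lt_mn' co' d /(Pset_modelP R m0 lt_mn co)[p [b [q [M ->]]]].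
have [q' [M' leE]] := model_transfer m0 m0' M.
exists b, (times p q); split=> //; first exact: model_core M.
have -> : times p q = times p q'.
  by congr sort; apply: funext => i; apply: funext => j; rewrite leE.
exact: Pset_model M'.
Qed.

Theorem theorem2p14 (R : realType) (m n : nat)
  (hm : (0 < m)%N) (hmn : (2 * m < n)%N) (hcop : coprime m n) :
  [/\ (forall d, Pset R 2 1 0 LB d -> Pset R n m (m - 1) LB (phi n m d)),
      (forall d1 d2, Pset R 2 1 0 LB d1 -> Pset R 2 1 0 LB d2 ->
         phi n m d1 = phi n m d2 -> d1 = d2),
      (forall d', Pset R n m (m - 1) LB d' ->
         exists2 d, Pset R 2 1 0 LB d & phi n m d = d'),
      (forall d, TTset R 2 1 0 LB d -> TTset R n m (m - 1) LB (phi n m d)) &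
      (forall d', TTset R n m (m - 1) LB d' ->
         exists2 d, TTset R 2 1 0 LB d & phi n m d = d')].
Proof.
have lt_mn : m < n by lia.
have to_n := @Pset_transfer R 2 1 n m isT isT isT hm lt_mn hcop.
have to_2 := @Pset_transfer R n m 2 1 hm lt_mn hcop isT isT isT.
split.
- by move=> d /to_n[b [L [C -> Pn]]]; rewrite (phi_mkdata C).
- move=> d1 d2 /to_n[b1 [L1 [C1 -> _]]] /to_n[b2 [L2 [C2 -> _]]].
  rewrite !phi_mkdata // => /(congr1 (unphi n m)).
  by rewrite !unphi_mkdata.
(* The preimage is the same [(b, L)] read on the 2-star. *)
- move=> d' /to_2[b [L [C -> P2]]].
  by exists (mkdata 2 1 b L); rewrite ?phi_mkdata.
- move=> d Td; have [P2 _ _ _ _] := Td; have [b [L [C dE Pn]]] := to_n d P2.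
  rewrite dE in Td P2 *; rewrite phi_mkdata //.
  by apply/(TTset_iff C hm lt_mn hcop P2 Pn).
- move=> d' Td; have [Pn _ _ _ _] := Td; have [b [L [C dE P2]]] := to_2 d' Pn.
  rewrite dE in Td Pn *; exists (mkdata 2 1 b L); last exact: phi_mkdata.
  by apply/(TTset_iff C hm lt_mn hcop P2 Pn).
Qed.
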